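(* Let $k\ge 0$ and $\delta\ge k+2$ be integers, and let $n$ be sufficiently large (i.e. $n\ge n_0(k,\delta)$ for some $n_0$ depending only on $k$ and $\delta$). If $G$ is an $n$-vertex graph with minimum degree $\delta(G)\ge\delta$ and $$q(G)\ge 2(n-\delta+k-1),$$ then $G$ is $k$-edge-Hamiltonian unless $G\in\mathcal{H}_{n,k,\delta}^{(1)}$ or $G\in\mathcal{L}_{n,k,\delta}^{(1)}$.
   Context: All graphs are finite and simple, considered up to isomorphism. $q(G)$ is the signless Laplacian spectral radius, i.e. the largest eigenvalue of $Q(G)=D(G)+A(G)$, where $A(G)$ is the adjacency matrix and $D(G)$ the diagonal matrix of vertex degrees. $K_s$ is the complete graph on $s$ vertices, $I_t$ is the edgeless graph on $t$ vertices, $G\cup H$ is the disjoint union, and $G\vee H$ is the join (obtained from $G\cup H$ by adding all edges between $G$ and $H$). A Hamilton cycle is a cycle through all vertices. A graph $G$ is $k$-edge-Hamiltonian if any collection of vertex-disjoint paths in $G$ with at most $k$ edges altogether is contained in a Hamilton cycle of $G$. Define $H_{n,k,\delta}:=K_\delta\vee(K_{n-2\delta+k}\cup I_{\delta-k})$. In it, let $X$ be the set of $\delta-k$ vertices (of degree $\delta$) of $I_{\delta-k}$, $Y$ the set of $\delta$ vertices (of degree $n-1$) of $K_\delta$, and $Z$ the set of the remaining $n-2\delta+k$ vertices (of degree $n-\delta+k-1$). Let $E_1(H_{n,k,\delta})$ be the set of edges with both endpoints in $Y\cup Z$, and $$\mathcal{H}_{n,k,\delta}^{(1)}=\{H_{n,k,\delta}\setminus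 E' : E'\subseteq E_1(H_{n,k,\delta}),\ |E'|\le\lfloor\delta(\delta-k)/4\rfloor\},$$ where $G\setminus E'$ means deleting the edges of $E'$. Define $L_{n,k,\delta}:=K_{k+1}\vee(K_{n-\delta-1}\cup K_{\delta-k})$. In it, let $X$ be the set of vertices (of degree $\delta$) of $K_{\delta-k}$, $Y$ the set of vertices (of degree $n-1$) of $K_{k+1}$, and $Z$ the set of the remaining $n-\delta-1$ vertices (of degree $n-\delta+k-1$). Let $E_1(L_{n,k,\delta})$ be the set of edges with both endpoints in $Y\cup Z$, and $$\mathcal{L}_{n,k,\delta}^{(1)}=\{L_{n,k,\delta}\setminus E' : E'\subseteq E_1(L_{n,k,\delta}),\ |E'|\le\lfloor(k+1)(\delta-k)/4\rfloor\}.$$ *)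

(* Defs.v *)
From mathcomp Require Import all_boot all_order all_algebra.
From mathcomp Require Import classical_sets reals.

Set Implicit Arguments.
Unset Strict Implicit.
Unset Printing Implicit Defensive.

Import Order.TTheory GRing.Theory Num.Theory.
Local Open Scope nat_scope.

Record graph := Graph {
  vertex :> finType;
  adj : rel vertex;
  adj_sym : symmetric adj;
  adj_irr : irreflexive adj }.
Arguments adj {g} : rename.

Definition iso (G H : graph) : Prop :=
  exists2 f : G -> H, bijective f & forall x y, adj (f x) (f y) = adj x y.

Definition edges (G : graph) : {set {set G}} :=
  [set e : {set G} | [exists x, exists y, adj x y && (e == [set x; y])]].

Definition deg (G : graph) (v : G) : nat := #|[set w | adj v w]|.

(* Degrees are smaller than #|G|, so the default value #|G| is only reached by
   the graph without vertices. *)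
Definition min_degree (G : graph) : nat := \big[minn/#|G|]_(v : G) deg v.

Section Constructions.

Definition complete_rel n : rel 'I_n := fun x y => x != y.

Lemma complete_sym n : symmetric (@complete_rel n).
Proof. by move=> x y; rewrite /complete_rel eq_sym. Qed.

Lemma complete_irr n : irreflexive (@complete_rel n).
Proof. by move=> x; rewrite /complete_rel eqxx. Qed.

Definition complete n : graph := Graph (@complete_sym n) (@complete_irr n).

Definition edgeless_rel n : rel 'I_n := fun _ _ => false.

Lemma edgeless_sym n : symmetric (@edgeless_rel n).
Proof. by []. Qed.

Lemma edgeless_irr n : irreflexive (@edgeless_rel n).
Proof. by []. Qed.

Definition edgeless n : graph := Graph (@edgeless_sym n) (@edgeless_irr n).

(* [b] tells whether the two sides are completely joined or left apart. *)
Definition sum_rel (b : bool) (G H : graph) : rel (G + H)%type :=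
  fun u v => match u, v with
             | inl x, inl y => adj x y
             | inr x, inr y => adj x y
             | _, _ => b
             end.

Lemma sum_rel_sym b G H : symmetric (@sum_rel b G H).
Proof. by move=> [x|x] [y|y] //=; rewrite adj_sym. Qed.

Lemma sum_rel_irr b G H : irreflexive (@sum_rel b G H).
Proof. by move=> [x|x] /=; rewrite adj_irr. Qed.

Definition disjoint_union (G H : graph) : graph :=
  Graph (@sum_rel_sym false G H) (@sum_rel_irr false G H).

Definition join (G H : graph) : graph :=
  Graph (@sum_rel_sym true G H) (@sum_rel_irr true G H).

Definition delete_rel (G : graph) (E : {set {set G}}) : rel G :=
  fun x y => adj x y && ([set x; y] \notin E).

Lemma delete_sym (G : graph) (E : {set {set G}}) : symmetric (delete_rel E).
Proof. by move=> x y; rewrite /delete_rel adj_sym finset.setUC. Qed.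

Lemma delete_irr (G : graph) (E : {set {set G}}) : irreflexive (delete_rel E).
Proof. by move=> x; rewrite /delete_rel adj_irr. Qed.

Definition delete_edges (G : graph) (E : {set {set G}}) : graph :=
  Graph (delete_sym E) (delete_irr E).

End Constructions.

Definition path_edges (G : graph) (p : seq G) : seq {set G} :=
  [seq [set e.1; e.2] | e <- zip p (behead p)].

Definition cycle_edges (G : graph) (c : seq G) : seq {set G} :=
  [seq [set x; next c x] | x <- c].

Definition is_path (G : graph) (p : seq G) : bool :=
  [&& p != [::], uniq p & sorted adj p].

Definition hamilton_cycle (G : graph) (c : seq G) : bool :=
  [&& 2 < size c, uniq c, cycle adj c & [forall x : G, x \in c]].

(* As each path is nonrepeating, [uniq (flatten ps)] says that the paths of
   [ps] are pairwise vertex-disjoint. *)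
Definition edge_hamiltonian (k : nat) (G : graph) : Prop :=
  forall ps : seq (seq G),
    all (@is_path G) ps -> uniq (flatten ps) ->
    \sum_(p <- ps) size (path_edges p) <= k ->
    exists2 c : seq G, hamilton_cycle c &
      forall p, p \in ps -> {subset path_edges p <= cycle_edges c}.

Section SignlessLaplacian.
Local Open Scope ring_scope.

Definition adjacency_mx (R : realType) (G : graph) : 'M[R]_#|G| :=
  \matrix_(i, j) (adj (enum_val i) (enum_val j))%:R.

Definition degree_mx (R : realType) (G : graph) : 'M[R]_#|G| :=
  diag_mx (\row_i (deg (enum_val i))%:R).

Definition signless_laplacian (R : realType) (G : graph) : 'M[R]_#|G| :=
  degree_mx R G + adjacency_mx R G.

(* The matrix is real symmetric: when G has a vertex, its set of eigenvalues is
   finite and nonempty, so that the supremum is the largest eigenvalue. *)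
Definition signless_radius (R : realType) (G : graph) : R :=
  sup [set a : R | eigenvalue (signless_laplacian R G) a]%classic.

End SignlessLaplacian.

(* In the join of A with the disjoint union of B and C, the parts are
   Y = A, Z = B and X = C. *)
Section Parts.
Variables A B C : graph.

Definition partY : {set join A (disjoint_union B C)} :=
  [set (inl a : join A (disjoint_union B C)) | a : A].

Definition partZ : {set join A (disjoint_union B C)} :=
  [set (inr (inl b) : join A (disjoint_union B C)) | b : B].

Definition edges_YZ : {set {set join A (disjoint_union B C)}} :=
  [set e in edges (join A (disjoint_union B C)) | e \subset partY :|: partZ].

End Parts.

(* The truncated subtraction of H_graph is the integer one as soon as
   2 * delta <= n + k, and that of L_graph as soon as delta < n. *)
Definition H_graph (n k delta : nat) : graph :=
  join (complete delta)
       (disjoint_union (complete (n + k - 2 * delta)) (edgeless (delta - k))).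

Definition E1_H (n k delta : nat) : {set {set H_graph n k delta}} :=
  edges_YZ (complete delta) (complete (n + k - 2 * delta))
           (edgeless (delta - k)).

Definition family_H (n k delta : nat) (G : graph) : Prop :=
  exists E' : {set {set H_graph n k delta}},
    [/\ E' \subset E1_H n k delta,
        #|E'| <= (delta * (delta - k)) %/ 4
      & iso G (delete_edges E')].

Definition L_graph (n k delta : nat) : graph :=
  join (complete k.+1)
       (disjoint_union (complete (n - delta - 1)) (complete (delta - k))).

Definition E1_L (n k delta : nat) : {set {set L_graph n k delta}} :=
  edges_YZ (complete k.+1) (complete (n - delta - 1)) (complete (delta - k)).

Definition family_L (n k delta : nat) (G : graph) : Prop :=
  exists E' : {set {set L_graph n k delta}},
    [/\ E' \subset E1_L n k delta,
        #|E'| <= (k.+1 * (delta - k)) %/ 4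
      & iso G (delete_edges E')].

(* Main.v *)
(* Write s = delta - k and b(v) = n - 1 - deg(v).  Evaluating the eigenvalue
   equation at a vertex maximizing |f(v)| / deg(v) turns the hypothesis on q(G)
   into sum_v b(v) <= 2 s (n - 1).

   Suppose that no Hamilton cycle contains a given system of paths with at most
   k edges.  As in the Bondy-Chvatal closure, edges uv with
   deg(u) + deg(v) >= n + k can be added without creating such a cycle.  In the
   closed graph the edge count forces, for n large, a clique on n - s vertices,
   while the s remaining ones (the set X) have degree exactly k + s, share the
   same neighbours Y in the clique and induce an r-regular graph, so that
   |Y| + r = k + s.  If 0 < r < s - 1, the given paths can be extended to a
   spanning path system none of whose paths ends in X, and the paths close up to
   a Hamilton cycle through the clique; hence r = 0 or r = s - 1, and G is a
   spanning subgraph of H or L.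

   By the minimum degree condition the missing edges lie outside X, and there
   are O(1) of them.  An eigenvector normalized to maximum 1 is then 1 - O(1/n)
   outside X and O(1/n) on X.  Comparing the quadratic form with that of the
   clique on n - s vertices, each missing edge costs 4 - O(1/n) and each edge
   between X and Y brings at most 1 + O(1/n), which gives the bound on the
   number of missing edges by integrality. *)
Require Import Defs.
From mathcomp Require Import all_boot all_order all_algebra.
From mathcomp Require Import classical_sets reals.
From mathcomp Require Import zify ring lra.

Set Implicit Arguments.
Unset Strict Implicit.
Unset Printing Implicit Defensive.

Import Order.TTheory GRing.Theory Num.Theory.
Local Open Scope nat_scope.

(** * Path systems *)

Section PathEdges.
Variable G : graph.
Implicit Types (p q c : seq G) (x y : G).

Lemma size_path_edges p : size (path_edges p) = (size p).-1.
Proof. by rewrite size_map size_zip size_behead; case: p => //= x p; lia. Qed.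

Lemma path_edges_cat x p y q :
  path_edges ((x :: p) ++ y :: q) =
  path_edges (x :: p) ++ [set last x p; y] :: path_edges (y :: q).
Proof. by elim: p x => [|z p IHp] x //=; rewrite -(IHp z). Qed.

Lemma sub_path_edges_cat p q :
  {subset path_edges p ++ path_edges q <= path_edges (p ++ q)}.
Proof.
case: p => [|x p] //; case: q => [|y q]; first by rewrite !cats0.
by move=> a; rewrite path_edges_cat !mem_cat in_cons => /orP[->|->]; rewrite ?orbT.
Qed.

Lemma path_edges_rev p : path_edges (rev p) = rev (path_edges p).
Proof.
elim: p => [|x [|y p] IHp] //.
have -> : path_edges [:: x, y & p] = [set x; y] :: path_edges (y :: p) by [].
rewrite rev_cons [RHS]rev_cons -IHp.
have: last x (rev (y :: p)) = y by rewrite rev_cons last_rcons.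
have: 0 < size (rev (y :: p)) by rewrite size_rev.
case: (rev (y :: p)) => [|z q] //= _ zy.
by rewrite -cats1 path_edges_cat /= zy finset.setUC cats1.
Qed.

(** [next] reads the first occurrence of a vertex, so uniqueness makes each position lead to the
    following one; the last vertex leads back to [x]. *)
Lemma cycle_edgesE x p :
  uniq (x :: p) -> cycle_edges (x :: p) = path_edges (x :: rcons p x).
Proof.
move=> Up; apply: (@eq_from_nth _ finset.set0) => [|i].
  by rewrite size_map size_path_edges /= size_rcons.
rewrite size_map => lt_ip.
rewrite (nth_map x) // next_nth mem_nth // index_uniq //.
rewrite /path_edges (nth_map (x, x)); last first.
  by rewrite size_zip /= size_rcons minnC; move: lt_ip => /=; lia.
rewrite nth_zip_cond /= size_zip /= size_rcons.
have -> : i < minn (size p).+2 (size p).+1 by move: lt_ip => /=; lia.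
rewrite nth_rcons -rcons_cons nth_rcons lt_ip /=.
case: ltnP => [|le_pi] //; rewrite (nth_default _ le_pi).
by case: eqP.
Qed.

Lemma sub_path_cycle_edges p : uniq p -> {subset path_edges p <= cycle_edges p}.
Proof.
case: p => [|x p] // Up a ap; rewrite cycle_edgesE // -rcons_cons -cats1.
by apply: sub_path_edges_cat; rewrite mem_cat ap.
Qed.

End PathEdges.

(** * Path systems and joins at path ends *)

Section PathSystems.
Variables (G : graph) (e : rel G).
Hypothesis e_sym : symmetric e.
Implicit Types (p q c : seq G) (ps : seq (seq G)) (F : seq {set G}).

(* A one-vertex path has its vertex as an end twice, so that a vertex of degree d
   in the path system is an end [2 - d] times. *)
Definition ends p : seq G := if p is x :: q then [:: x; last x q] else [::].

Lemma ends_cat x p y q : ends ((x :: p) ++ y :: q) = [:: x; last y q].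
Proof. by rewrite /= last_cat. Qed.

Lemma ends_rev p : ends (rev p) = rev (ends p).
Proof.
case: p => [|x p] //; rewrite rev_cons; case: (lastP p) => [|q y] //.
by rewrite rev_rcons /= last_rcons last_rcons.
Qed.

Lemma mem_ends p x : x \in ends p -> x \in p.
Proof.
case: p => [|y p] //; rewrite !inE => /orP[->|/eqP->] //.
by rewrite -in_cons mem_last.
Qed.

(** Adjacency is a bare relation because the closure changes it on a fixed vertex set. Nonrepetition
    is a condition on the whole system. *)
Definition path_of p := (p != [::]) && sorted e p.

Lemma sorted_rev_sym p : sorted e (rev p) = sorted e p.
Proof. by rewrite rev_sorted; case: p => //= x p; apply: eq_path => u v; apply: e_sym. Qed.

Lemma path_of_rev p : path_of (rev p) = path_of p.
Proof. by rewrite /path_of sorted_rev_sym -!size_eq0 size_rev. Qed.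

(* Up to reversing both paths, [u] is the last vertex of [p] and [v] the first
   vertex of [q]. *)
Lemma join_paths p q u v :
  path_of p -> path_of q -> u \in ends p -> v \in ends q -> e u v ->
  exists pq, [/\ path_of pq, perm_eq pq (p ++ q),
    {subset path_edges p ++ path_edges q <= path_edges pq} &
    forall A : {set G}, count (mem A) (ends p) + count (mem A) (ends q) =
      count (mem A) (ends pq) + (u \in A) + (v \in A)].
Proof.
have base p' q' : path_of p' -> path_of q' -> last u p' = u -> head v q' = v ->
    e u v -> exists pq, [/\ path_of pq, perm_eq pq (p' ++ q'),
    {subset path_edges p' ++ path_edges q' <= path_edges pq} &
    forall A : {set G}, count (mem A) (ends p') + count (mem A) (ends q') =
      count (mem A) (ends pq) + (u \in A) + (v \in A)].
  case: p' => [|x p'] //; case: q' => [|y q'] // /andP[_ pp] /andP[_ pq].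
  move=> /= lastp yv uv; subst v; exists ((x :: p') ++ y :: q'); split=> //.
  - by rewrite /path_of /= cat_path /= lastp (pp : path e x p') uv.
  - exact: sub_path_edges_cat.
  - by move=> A; rewrite ends_cat /= lastp; lia.
move=> pp pq up vq uv.
have rev_or r w : path_of r -> w \in ends r -> last w r = w \/ head w r = w.
  by case: r => [|x r] // _; rewrite !inE => /orP[]/eqP ->; [right|left].
have [p' [pp' permp subp endp lastp]] : exists p', [/\ path_of p', perm_eq p' p,
    {subset path_edges p <= path_edges p'},
    (forall A, count A (ends p) = count A (ends p')) & last u p' = u].
  have [lp|hp] := rev_or _ _ pp up; first by exists p; split.
  exists (rev p); split=> //.
  - by rewrite path_of_rev.
  - by rewrite perm_rev.
  - by move=> a; rewrite path_edges_rev mem_rev.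
  - by move=> A; rewrite ends_rev count_rev.
  - by case: (p) hp => [|x r] //= ->; rewrite rev_cons last_rcons.
have [q' [pq' permq subq endq headq]] : exists q', [/\ path_of q', perm_eq q' q,
    {subset path_edges q <= path_edges q'},
    (forall A, count A (ends q) = count A (ends q')) & head v q' = v].
  have [lq|hq] := rev_or _ _ pq vq; last by exists q; split.
  exists (rev q); split=> //.
  - by rewrite path_of_rev.
  - by rewrite perm_rev.
  - by move=> a; rewrite path_edges_rev mem_rev.
  - by move=> A; rewrite ends_rev count_rev.
  - case: (lastP q) lq vq => [|r x] //.
    by rewrite last_rcons rev_rcons => ->.
have [pq0 [H1 H2 H3 H4]] := base _ _ pp' pq' lastp headq uv.
exists pq0; split=> //.
- by rewrite (perm_trans H2) // perm_cat.
- move=> a; rewrite mem_cat => /orP[/subp|/subq] H;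
    by apply: H3; rewrite mem_cat H ?orbT.
- by move=> A; rewrite endp endq.
Qed.

(** [F] lists the prescribed edges, which every join must keep. Vertices off the given paths enter
    as one-vertex paths. *)
Definition spanning F ps :=
  [/\ all path_of ps, perm_eq (flatten ps) (enum G) &
      {subset F <= flatten (map (@path_edges G) ps)}].

Definition ends_in (A : {set G}) ps := count (mem A) (flatten (map ends ps)).

Lemma ends_in_cons A p ps :
  ends_in A (p :: ps) = count (mem A) (ends p) + ends_in A ps.
Proof. by rewrite /ends_in /= count_cat. Qed.

Lemma ends_in_perm A ps qs : perm_eq ps qs -> ends_in A ps = ends_in A qs.
Proof.
by move=> pq; apply/permP; apply: perm_flatten; apply: perm_map.
Qed.

Lemma spanning_perm F ps qs : perm_eq ps qs -> spanning F ps -> spanning F qs.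
Proof.
move=> pq [H1 H2 H3]; split.
- by rewrite -(perm_all _ pq).
- by rewrite -(permPr H2) perm_flatten // perm_sym.
- by move=> a /H3; rewrite (perm_mem (perm_flatten (perm_map _ pq))).
Qed.

Lemma join_in_system F p q ps u v :
  spanning F (p :: q :: ps) -> u \in ends p -> v \in ends q -> e u v ->
  exists pq, [/\ spanning F (pq :: ps), perm_eq pq (p ++ q) &
    forall A : {set G},
      ends_in A [:: p, q & ps] = ends_in A (pq :: ps) + (u \in A) + (v \in A)].
Proof.
move=> [/= /and3P[pp pq pps] perms subF] up vq uv.
have [r [H1 H2 H3 H4]] := join_paths pp pq up vq uv.
exists r; split=> //.
- split=> /=; first by rewrite H1.
    by rewrite -(permPr perms) catA perm_cat2r.
  move=> a /subF; rewrite /= !mem_cat => /orP[ap|/orP[aq|->]]; last by rewrite orbT.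
    by rewrite (H3 a) // mem_cat ap.
  by rewrite (H3 a) // mem_cat aq orbT.
- move=> A; rewrite !ends_in_cons addnA H4 -!addnA; congr (_ + _).
  by rewrite addnA addnC.
Qed.

Lemma spanning_uniq F ps : spanning F ps -> uniq (flatten ps).
Proof. by case=> _ H _; rewrite (perm_uniq H) enum_uniq. Qed.

Lemma spanning_cover F ps x : spanning F ps -> exists2 p, p \in ps & x \in p.
Proof. by case=> _ H _; apply/flattenP; rewrite (perm_mem H) mem_enum. Qed.

Lemma ends_in_sub (A : {set G}) p ps : p \in ps ->
  count (mem A) (ends p) <= ends_in A ps.
Proof. by move=> pp; rewrite (ends_in_perm A (perm_to_rem pp)) ends_in_cons leq_addr. Qed.

Lemma ends_in_gt0 (A : {set G}) ps : 0 < ends_in A ps ->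
  exists p, exists2 u, p \in ps & (u \in ends p) && (u \in A).
Proof.
rewrite -has_count => /hasP[u /flattenP[_ /mapP[p pp ->] up] uA].
by exists p, u => //; rewrite up.
Qed.

Lemma size_ends p : size (ends p) <= 2. Proof. by case: p. Qed.

(* Joining an X-end to a Y-end of another path keeps the number of Y-ends
   minus that of X-ends; a path with an X-end has at most one Y-end, so while
   this difference is positive such a join is possible. *)
Lemma remove_ends F ps (X Y : {set G}) :
  [disjoint X & Y] -> (forall x y, x \in X -> y \in Y -> e x y) ->
  spanning F ps -> ends_in X ps < ends_in Y ps ->
  exists2 qs, spanning F qs & ends_in X qs = 0.
Proof.
move=> disj eXY; have [m] := ubnP (size ps).
elim: m ps => [|m IH] ps //= lt_m span lt_XY.
have [E|] := posnP (ends_in X ps); first by exists ps.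
move=> /ends_in_gt0[p [u pp /andP[up uX]]].
have perm1 := perm_to_rem pp.
have span1 := spanning_perm perm1 span.
have sz := perm_size perm1; rewrite /= in sz.
have uY : u \notin Y by rewrite (disjointFr disj).
have [E|] := posnP (ends_in Y (rem p ps)).
  have := lt_XY; rewrite !(ends_in_perm _ perm1) !ends_in_cons E.
  have : 0 < count (mem X) (ends p).
    by rewrite -has_count; apply/hasP; exists u.
  have : count (mem X) (ends p) + count (mem Y) (ends p) <= size (ends p).
    rewrite -count_predUI -[leqRHS]addn0; apply: leq_add; first exact: count_size.
    rewrite leqNgt -has_count; apply/hasPn => w _ /=.
    by apply/andP => -[wX wY]; rewrite (disjointFr disj wX) in wY.
  by have := size_ends p; lia.
move=> /ends_in_gt0[q [v qq /andP[vq vY]]].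
have perm2 := perm_to_rem qq.
have perm12 : perm_eq ps [:: p, q & rem q (rem p ps)].
  by rewrite (permPl perm1) perm_cons.
have sz2 := perm_size perm12; rewrite /= in sz2.
have span2 := spanning_perm perm12 span.
have [pq [span3 _ ends3]] := join_in_system span2 up vq (eXY _ _ uX vY).
have vX : v \notin X by rewrite (disjointFl disj).
have HX := ends3 X; have HY := ends3 Y.
rewrite uX (negPf vX) -(ends_in_perm _ perm12) in HX.
rewrite (negPf uY) vY -(ends_in_perm _ perm12) in HY.
apply: (IH _ _ span3); first by rewrite /= -ltnS -sz2.
by move: lt_XY; rewrite HX HY /= !addn0 ltn_add2r.
Qed.

Definition blockwise (X : {set G}) p := all (mem X) p || ~~ has (mem X) p.

(** Adjacent [X]-ends of different paths are joined as long as possible; each join lowers the number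
    of paths. If all paths are [blockwise], a path with an end in [X] lies in [X], and so does the
    result of joining two of them. *)
Lemma join_adjacent_ends F ps (X Y : {set G}) :
  [disjoint X & Y] -> spanning F ps -> exists qs,
  [/\ spanning F qs, ends_in Y qs = ends_in Y ps,
      ends_in X qs <= ends_in X ps,
      all (blockwise X) ps -> all (blockwise X) qs &
      forall p q u v, p \in qs -> q \in qs -> p != q -> u \in ends p ->
        v \in ends q -> u \in X -> v \in X -> ~~ e u v].
Proof.
move=> disj; have [m] := ubnP (size ps).
elim: m ps => [|m IH] ps //= lt_m span.
have [/hasP[p pp /hasP[q qq /and3P[pq up /hasP[v vq /andP[vX uv]]]]]|none] :=
  boolP (has (fun p => has (fun q => [&& p != q, true & has (fun v => (v \in X) &&
     has (fun u => (u \in X) && e u v) (ends p)) (ends q)]) ps) ps).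
  have /hasP[u {}up /andP[uX {}uv]] := uv.
  have perm1 := perm_to_rem pp.
  have qq' : q \in rem p ps.
    by have := qq; rewrite (perm_mem perm1) inE eq_sym (negPf pq).
  have perm12 : perm_eq ps [:: p, q & rem q (rem p ps)].
    by rewrite (permPl perm1) perm_cons perm_to_rem.
  have sz2 := perm_size perm12; rewrite /= in sz2.
  have span2 := spanning_perm perm12 span.
  have [r [span3 permr ends3]] := join_in_system span2 up vq uv.
  have uY : (u \in Y) = false by apply: (disjointFr disj).
  have vY : (v \in Y) = false by apply: (disjointFr disj).
  have HX := ends3 X; have HY := ends3 Y.
  rewrite -(ends_in_perm _ perm12) in HX.
  rewrite uY vY -(ends_in_perm _ perm12) in HY.
  have [|qs [H1 H2 H3 H4 H5]] := IH _ _ span3; first by rewrite /= -ltnS -sz2.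
  exists qs; split=> //; first by rewrite H2 HY !addn0.
    by rewrite (leq_trans H3) // HX -addnA leq_addr.
  rewrite (perm_all _ perm12) /= => /and3P[bp bq bps]; apply: H4.
  rewrite /= bps andbT /blockwise; apply/orP; left.
  rewrite (perm_all _ permr) all_cat.
  have in_X s w : blockwise X s -> w \in ends s -> w \in X -> all (mem X) s.
    move=> /orP[//|/hasPn H] /mem_ends ws wX.
    by have := H _ ws; rewrite /= wX.
  by rewrite (in_X p u) // (in_X q v).
exists ps; split=> // p q u v pp qq pq up vq uX vX; apply: contra none => uv.
apply/hasP; exists p => //; apply/hasP; exists q => //; rewrite pq /=.
by apply/hasP; exists v => //; rewrite vX; apply/hasP; exists u => //; rewrite uX.
Qed.

(* When no end lies in [X], all ends lie in the clique [~: X], so the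
   paths can be concatenated in any order. *)
Lemma close_up F ps (X : {set G}) :
  2 < #|G| -> (forall u v, u \notin X -> v \notin X -> u != v -> e u v) ->
  spanning F ps -> ends_in X ps = 0 ->
  exists c, [/\ perm_eq c (enum G), cycle e c & {subset F <= cycle_edges c}].
Proof.
move=> n_gt2 clique span noX.
have [pps perms subF] := span; have U := spanning_uniq span.
have outX p u : p \in ps -> u \in ends p -> u \notin X.
  move=> pp up; apply/negP => uX.
  have := ends_in_sub X pp; rewrite noX leqn0 -[_ == 0]negbK -lt0n -has_count.
  by move=> /negP; apply; apply/hasP; exists u.
exists (flatten ps); split=> //; last first.
  move=> a /subF /flattenP[_ /mapP[p pp ->] ap].
  apply: (sub_path_cycle_edges U).
  elim: (ps) pp => [|q qs IH] //=; rewrite inE => /orP[/eqP<-|pq];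
    by apply: sub_path_edges_cat; rewrite mem_cat ?ap // (IH pq) orbT.
have concat qs : {subset qs <= ps} -> uniq (flatten qs) -> sorted e (flatten qs) /\
   forall x, (flatten qs != [::]) ->
   (head x (flatten qs) \notin X) /\ (last x (flatten qs) \notin X).
  elim: qs => [|q qs IH] //= sub; rewrite cat_uniq => /and3P[Uq disj Uqs].
  have [|sqs hqs] := IH _ Uqs; first by move=> r rq; apply: sub; rewrite inE rq orbT.
  have qps : q \in ps by apply: sub; rewrite inE eqxx.
  have /andP[] := allP pps _ qps.
  case: q qps disj {Uq sub IH} => [|y q] // qps disj _ sq.
  have yX : y \notin X by apply: (outX _ _ qps); rewrite inE eqxx.
  have lX : last y q \notin X by apply: (outX _ _ qps); rewrite !inE eqxx orbT.
  case: (flatten qs) sqs hqs disj => [|z s] sqs hqs disj.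
    by rewrite cats0; split.
  have [zX lsX] := hqs y isT.
  split=> [|x _] /=; last by rewrite last_cat.
  rewrite cat_path (sq : path e y q) /= clique // ?sqs //.
  apply: contra disj => /eqP <-; apply/hasP.
  by exists (last y q); [apply: mem_head | apply: mem_last].
have [|srt hl] := concat ps _ U; first by [].
have szf : 2 < size (flatten ps) by rewrite (perm_size perms) -cardE.
case: (flatten ps) U szf srt hl => [|x s] // U szf srt hl.
rewrite /= rcons_path; apply/andP; split=> //.
have [hX lX] := hl x isT.
apply: clique => //.
case: (s) szf U => [|y t] //= _ /andP[xnot _].
by apply: contra xnot => /eqP <-; apply: mem_last.
Qed.

End PathSystems.

(** * Counting path ends *)

Section EndCounting.
Variables (G : graph) (e : rel G).
Implicit Types (p q : seq G) (ps : seq (seq G)) (A : {set G}).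

Lemma ends_in_sum A ps : ends_in A ps = \sum_(x in A) ends_in [set x] ps.
Proof.
rewrite /ends_in; elim: (flatten _) => [|y s IH] /=.
  by rewrite big1.
rewrite IH big_split /=; congr (_ + _).
under eq_bigr => x _ do rewrite inE.
have [yA|yA] := boolP (y \in A).
  by rewrite (bigD1 y) //= eqxx big1 // => x /andP[_ /negPf]; rewrite eq_sym => ->.
rewrite big1 // => x xA; apply/eqP; rewrite eqb0; apply: contra yA => /eqP ->.
exact: xA.
Qed.

Lemma ends_in_set1 ps p x : uniq (flatten ps) -> p \in ps -> x \in p ->
  ends_in [set x] ps = count_mem x (ends p).
Proof.
move=> U pp xp; rewrite (ends_in_perm _ (perm_to_rem pp)) ends_in_cons.
have U' : uniq (flatten (p :: rem p ps)).
  by rewrite -(perm_uniq (perm_flatten (perm_to_rem pp))).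
rewrite -[RHS]addn0; congr (_ + _); first by apply: eq_count => u; rewrite /= inE.
apply/eqP; rewrite -leqn0 leqNgt; apply/negP => /ends_in_gt0[q [u qq /andP[uq]]].
rewrite inE => /eqP ux; subst u.
move: U'; rewrite /= cat_uniq => /and3P[_ /hasPn disj _].
have /disj : x \in flatten (rem p ps) by apply/flattenP; exists q => //; apply: mem_ends.
by rewrite /= xp.
Qed.

Lemma ends_in_set1_le2 F ps x : spanning e F ps -> ends_in [set x] ps <= 2.
Proof.
move=> span; have [p pp xp] := spanning_cover x span.
rewrite (ends_in_set1 (spanning_uniq span) pp xp).
exact: leq_trans (count_size _ _) (size_ends p).
Qed.

Lemma ends_in_le F ps A : spanning e F ps -> ends_in A ps <= 2 * #|A|.
Proof.
move=> span; rewrite ends_in_sum mulnC -sum_nat_const.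
by apply: leq_sum => x _; apply: ends_in_set1_le2 span.
Qed.

Lemma ends_inT ps : all (path_of e) ps -> ends_in [set: G] ps = 2 * size ps.
Proof.
elim: ps => //= p ps IH /andP[/andP[pn _] /IH E].
by rewrite ends_in_cons E mulnS; congr (_ + _); case: p pn => //= x p _; rewrite !inE.
Qed.

Lemma uniq_in_flatten ps p : uniq (flatten ps) -> p \in ps -> uniq p.
Proof.
move=> U /perm_to_rem/perm_flatten/perm_uniq; rewrite U /= cat_uniq.
by move=> /esym/and3P[].
Qed.

Definition singles ps : seq (seq G) :=
  [seq [:: x] | x <- enum G & x \notin flatten ps].

Lemma spanning_initial ps : all (path_of e) ps -> uniq (flatten ps) ->
  spanning e (flatten (map (@path_edges G) ps)) (ps ++ singles ps).
Proof.
move=> pps U; split.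
- by rewrite all_cat pps /= all_map; apply/allP.
- have -> : flatten (ps ++ singles ps) =
      flatten ps ++ [seq x <- enum G | x \notin flatten ps].
    by rewrite flatten_cat /singles flatten_map1 map_id.
  apply: uniq_perm; last by move=> x; rewrite mem_cat mem_filter mem_enum andbT orbN.
    rewrite cat_uniq U (filter_uniq _ (enum_uniq G)) andbT.
    by apply/hasPn => x; rewrite mem_filter => /andP[].
  exact: enum_uniq.
- by move=> a; rewrite map_cat flatten_cat mem_cat => ->.
Qed.

Lemma size_flatten_paths ps : all (path_of e) ps ->
  size (flatten ps) = size ps + \sum_(p <- ps) size (path_edges p).
Proof.
elim: ps => [|p ps IH] /=; first by rewrite big_nil.
move=> /andP[/andP[pn _] /IH E]; rewrite size_cat E big_cons size_path_edges.
by case: p pn => //= x p _; lia.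
Qed.

(** A spanning system with m edges consists of #|G| - m paths, each with two ends. *)
Lemma ends_in_initial ps k : all (path_of e) ps -> uniq (flatten ps) ->
  \sum_(p <- ps) size (path_edges p) <= k ->
  2 * #|G| <= ends_in [set: G] (ps ++ singles ps) + 2 * k.
Proof.
move=> pps U le_k; have [pps0 perms _] := spanning_initial pps U.
have := size_flatten_paths pps0; rewrite (perm_size perms) -cardE big_cat /=.
rewrite [X in _ + (_ + X)]big1_seq ?ends_inT //; first by lia.
by move=> _ /mapP[x _ ->]; rewrite size_path_edges.
Qed.

End EndCounting.

(** The counterpart of [hamilton_cycle] for a bare relation, with prescribed edges [F]; the length
    condition is kept apart as [n_gt2]. *)
Definition ham_with (G : graph) (e : rel G) (F : seq {set G}) :=
  exists c, [/\ perm_eq c (enum G), cycle e c & {subset F <= cycle_edges c}].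

(** * Completing a path system to a Hamilton cycle *)

Section Completion.
Variables (G : graph) (e : rel G).
Hypotheses (e_sym : symmetric e) (e_irr : irreflexive e) (n_gt2 : 2 < #|G|).
Variables (ps : seq (seq G)) (k : nat) (X : {set G}).
Hypotheses (paths_ps : all (path_of e) ps) (uniq_ps : uniq (flatten ps))
           (size_ps : \sum_(p <- ps) size (path_edges p) <= k)
           (cliqueXC : forall u v, u \notin X -> v \notin X -> u != v -> e u v).
Let F := flatten (map (@path_edges G) ps).

Lemma ham_complete : X = finset.set0 -> ham_with e F.
Proof.
move=> X0; apply: (close_up n_gt2 cliqueXC (spanning_initial paths_ps uniq_ps)).
by rewrite ends_in_sum X0 big_set0.
Qed.

Variables (Y : {set G}) (r : nat).
Hypotheses (disjXY : [disjoint X & Y])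
           (joinXY : forall x y, x \in X -> y \in Y -> e x y)
           (regX : forall x, x \in X -> #|[set u in X | e x u]| = r)
           (cardY : #|Y| + r = k + #|X|) (r_gt0 : 0 < r) (lt_rX : r + 1 < #|X|).

(* Exhausting the joins between [X]-ends leaves few [X]-ends: if an [X]-end
   remains, all of its neighbours in [X] but at most one are interior vertices
   of paths. *)
Lemma ham_regular : ham_with e F.
Proof.
have span0 := spanning_initial paths_ps uniq_ps.
have [qs [span1 endsY endsX blk nonadj]] := join_adjacent_ends e_sym disjXY span0.
have [lt_XY|le_YX] := ltnP (ends_in X qs) (ends_in Y qs).
  have [rs span2 noX] := remove_ends e_sym disjXY joinXY span1 lt_XY.
  exact: close_up cliqueXC span2 noX.
(* [c x] is 2 minus the degree of [x] in the system [qs], so that [A 0] below consists of the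
   vertices of [X] interior to a path. *)
set c := fun x => ends_in [set x] qs.
have U1 := spanning_uniq span1.
pose A i := [set x in X | c x == i].
have c_le2 x : c x <= 2 by apply: ends_in_set1_le2 span1.
have cardAE i : #|A i| = \sum_(x in X) (c x == i).
  rewrite -sum1_card big_mkcond [RHS]big_mkcond /=; apply: eq_bigr => x _.
  by rewrite inE; case: (x \in X); case: (c x == i).
have cardA : #|A 0| + #|A 1| + #|A 2| = #|X|.
  rewrite !cardAE -!big_split -sum1_card /=; apply: eq_bigr => x _.
  by have := c_le2 x; case: (c x) => [|[|[|]]].
have endsA : ends_in X qs = #|A 1| + 2 * #|A 2|.
  rewrite ends_in_sum !cardAE big_distrr -big_split /=; apply: eq_bigr => x _.
  by rewrite -/(c x); have := c_le2 x; case: (c x) => [|[|[|]]].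
have arith m a b d c1 i N : m <= 2 -> a + b = m -> d <= b -> N <= c1 + d - i ->
    N + a <= c1 + 2 by clear; lia.
(* A neighbour of [x] in [X] is interior to a path or the other end of the path of [x]; that other
   end exists only when [c x] is 1. *)
have nbrs x : x \in X -> 0 < c x -> r + c x <= #|A 0| + 2.
  move=> xX cx; have [p [u pp /andP[up]]] := ends_in_gt0 cx.
  rewrite inE => /eqP ux; subst u.
  have -> : c x = count_mem x (ends p) by apply: ends_in_set1 => //; apply: mem_ends.
  rewrite -(regX xX).
  have /subset_leq_card : [set u in X | e x u] \subset
      A 0 :|: [set u in [seq u <- ends p | u != x]].
    apply/fintype.subsetP => u; rewrite !inE => /andP[uX xu]; rewrite uX /=.
    case: posnP => //= cu; rewrite mem_filter; apply/andP; split.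
      by apply: contraTneq xu => ->; rewrite e_irr.
    have [q [v qq /andP[vq]]] := ends_in_gt0 cu; rewrite inE => /eqP vu; subst v.
    have [-> //|pq] := eqVneq p q.
    by have := nonadj p q x u pp qq pq up vq xX uX; rewrite xu.
  have : #|[set u in [seq u <- ends p | u != x]]| <= count (predC1 x) (ends p).
    by rewrite cardsE -size_filter card_size.
  have := count_predC (pred1 x) (ends p); have := size_ends p.
  have -> : count (predC (pred1 x)) (ends p) = count (predC1 x) (ends p) by [].
  by rewrite cardsU; apply: arith.
have endsT := ends_in_initial paths_ps uniq_ps size_ps.
have cardXY : #|X :|: Y| = #|X| + #|Y|.
  by apply/eqP; rewrite (eq_leqif (leq_card_setU X Y)).
have le_XYG : #|X| + #|Y| <= #|G| by rewrite -cardXY max_card.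
have splitT : ends_in [set: G] (ps ++ singles ps) <=
    ends_in X (ps ++ singles ps) + ends_in Y (ps ++ singles ps) +
      2 * (#|G| - #|X| - #|Y|).
  rewrite !(ends_in_sum _ (ps ++ singles ps)) (big_setID (X :|: Y)) /= finset.setTI.
  have -> : \sum_(i in X :|: Y) ends_in [set i] (ps ++ singles ps) =
      \sum_(i in X) ends_in [set i] (ps ++ singles ps) +
      \sum_(i in Y) ends_in [set i] (ps ++ singles ps).
    by rewrite -bigU //=; apply: eq_bigl => i; rewrite !inE.
  rewrite leq_add2l -ends_in_sum finset.setTD.
  by rewrite (leq_trans (ends_in_le _ span0)) // cardsCs finset.setCK cardXY subnDA.
have endsX0 := ends_in_le X span0.
have A1 : 0 < #|A 1| -> r <= #|A 0| + 1.
  by move=> /card_gt0P[x]; rewrite inE => /andP[xX /eqP cx]; have := nbrs x xX; lia.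
have A2 : 0 < #|A 2| -> r <= #|A 0|.
  by move=> /card_gt0P[x]; rewrite inE => /andP[xX /eqP cx]; have := nbrs x xX; lia.
(* The end counts yield 2 a0 + a1 + (2 x - x0) <= 2 r. With r + 1 < x, the bounds [A1] and [A2] then
   force a1 = 0, a0 = r and x0 = 2 x. *)
have arith2 a0 a1 a2 x1 y1 x0 y0 t n x y : a0 + a1 + a2 = x -> x1 = a1 + 2 * a2 ->
    y1 <= x1 -> y1 = y0 -> x0 <= 2 * x -> 2 * n <= t + 2 * k -> x + y <= n ->
    t <= x0 + y0 + 2 * (n - x - y) -> y + r = k + x -> r + 1 < x -> 0 < r ->
    (0 < a1 -> r <= a0 + 1) -> (0 < a2 -> r <= a0) ->
    [/\ x0 = 2 * x, a1 = 0 & 0 < a0].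
  by clear; move=> *; split; lia.
have [E A1_0] := arith2 _ _ _ _ _ _ _ _ _ _ _ cardA endsA le_YX endsY endsX0 endsT
  le_XYG splitT cardY lt_rX r_gt0 A1 A2.
(* Equality in the sum makes every vertex of [X] a one-vertex path of the initial system, which is
   therefore [blockwise]. *)
have c0 x : x \in X -> ends_in [set x] (ps ++ singles ps) = 2.
  have le2 y : y \in X -> ends_in [set y] (ps ++ singles ps) <= 2
      ?= iff (ends_in [set y] (ps ++ singles ps) == 2).
    by move=> _; apply/leqif_eq/(ends_in_set1_le2 _ span0).
  have [_] := leqif_sum le2.
  rewrite -ends_in_sum E sum_nat_const mulnC eqxx => /esym/forall_inP c02 xX.
  exact/eqP/c02.
case/card_gt0P => x; rewrite inE => /andP[xX /eqP cx].
(* The interior vertex [x] lies on a path [p] inside [X]. Either the first vertex of [p] is an end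
   exactly once, against #|A 1| = 0, or [p] is a single vertex, against [c x] = 0. *)
have [p pp xp] := spanning_cover x span1.
have : blockwise X p.
  apply: (allP (blk _)) => //; apply/allP => q qq.
  rewrite /blockwise orbC -implybE; apply/implyP => /hasP[y yq yX].
  have := c0 y yX; rewrite (ends_in_set1 (spanning_uniq span0) qq yq).
  have := uniq_in_flatten (spanning_uniq span0) qq.
  case: q {qq} yq => // z q yq; rewrite cons_uniq => /andP[zq _] /=.
  case: eqP => // zy; case: eqP => // ly _; subst z.
  case: q yq zq ly => [|w q] yq zq ly; first by rewrite /= (yX : y \in X).
  by case/negP: zq; move: ly => /= {1}<-; apply: mem_last.
rewrite /blockwise => /orP[/allP allX|/hasPn/(_ x xp)]; last by rewrite /= xX.
case: p pp xp allX => // h p pp xp allX.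
have hX : h \in X by apply: allX; rewrite mem_head.
have := c_le2 h.
have ch : c h = count_mem h (ends (h :: p)) by apply: ends_in_set1 => //; apply: mem_head.
have : c h != 1.
  apply/negP => ch1.
  have : h \in A 1 by rewrite inE hX ch1.
  by rewrite (cards0_eq A1_0) inE.
have hch : h != last h p -> c h = 1.
  by rewrite ch /= eqxx eq_sym => /negPf->.
have [hl _ _|/hch-> //] := eqVneq h (last h p).
case: p pp xp allX {ch hch} hl => [|w p] pp xp _ hl.
  move: xp cx; rewrite inE => /eqP-> ch0.
  by have := ends_in_set1 U1 pp (mem_head h [::]); rewrite -/(c h) ch0 /= eqxx.
have := uniq_in_flatten U1 pp; rewrite cons_uniq => /andP[/negP[]].
by rewrite {1}hl /= mem_last.
Qed.

End Completion.

(** * Closure *)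

Section Closure.
Variable G : graph.
Implicit Types (e : rel G) (F : seq {set G}).

Definition degr e (v : G) := #|[set w | e v w]|.

Definition add_edge e (u v : G) : rel G :=
  fun x y => e x y || ([set x; y] == [set u; v]).

Lemma set2_eq (u v x y : G) : [set x; y] = [set u; v] ->
  (x = u /\ y = v) \/ (x = v /\ y = u).
Proof.
move=> E; have := finset.set21 x y; have := finset.set22 x y.
have := finset.set21 u v; have := finset.set22 u v.
rewrite E -{1 2}E !inE.
move=> /orP[]/eqP v1 /orP[]/eqP u1 /orP[]/eqP y1 /orP[]/eqP x1; subst; auto.
Qed.

Lemma next_cons2 (x y : G) s : next [:: x, y & s] x = y.
Proof. by rewrite /= eqxx. Qed.

Lemma cycle_edges_rot i (c : seq G) : uniq c ->
  cycle_edges (rot i c) = rot i (cycle_edges c).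
Proof.
move=> U; rewrite /cycle_edges -map_rot; apply: eq_map => x.
by rewrite next_rot.
Qed.

Section Rotation.
Variable e : rel G.
Hypothesis e_sym : symmetric e.
Hypothesis n_gt2 : 2 < #|G|.

(** Two distinct vertices with the same outgoing edge would succeed each other, giving a cycle of
    length 2. *)
Lemma next_edge_inj (c : seq G) : perm_eq c (enum G) ->
  injective (fun w => [set w; next c w]).
Proof.
move=> permc w w' /set2_eq[[//]|[E1 E2]]; exfalso.
have U : uniq c by rewrite (perm_uniq permc) enum_uniq.
have wc : w \in c by rewrite (perm_mem permc) mem_enum.
have [i s E] := rot_to wc.
have : size (rot i c) = #|G| by rewrite size_rot (perm_size permc) -cardE.
have : uniq (rot i c) by rewrite rot_uniq.
move: E1 E2; rewrite -!(next_rot i U) E.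
case: s {E} => [|a [|b s]] Ew Ew' Us sz; move: (n_gt2); rewrite -?sz // => _.
move: Ew'; rewrite next_cons2 => Ew'; subst w'; move: Ew => /=.
case: eqP => [aw|_].
  by move: Us; rewrite aw /= inE eqxx.
by rewrite eqxx => wb; move: Us; rewrite wb cons_uniq !in_cons eqxx orbT.
Qed.

(* The rotation of Ore and Posa, avoiding the edges of F. *)
Lemma ham_path_close F k (x y : G) s :
  size F <= k -> perm_eq (y :: s) (enum G) -> path e y s -> last y s = x ->
  {subset F <= path_edges (y :: s)} -> ~~ e x x -> ~~ e y y ->
  #|G| + k <= degr e x + degr e y -> ham_with e F.
Proof.
move=> szF permP pth last_s subF exx eyy deg_ge.
set P := y :: s in permP subF.
have U : uniq P by rewrite (perm_uniq permP) enum_uniq.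
have memP w : w \in P by rewrite (perm_mem permP) mem_enum.
have nextx : next P x = y.
  rewrite next_nth memP -last_s {1}/P index_last //; exact: nth_default.
(* [S] is the neighbourhood of [y] shifted back by one. Neither set contains [x], whose successor is
   [y], as there are no loops; hence they share more than k vertices, and one of these has its
   outgoing edge outside [F]. *)
pose S := [set w | e y (next P w)]; pose T := [set w | e x w].
have cardS : #|S| = degr e y.
  rewrite /degr -[RHS](card_preimset _ (can_inj (prev_next U))).
  by apply: eq_card => w; rewrite !inE.
have cardST : #|S :|: T| < #|G|.
  rewrite -(cardsT G) (cardsD1 x [set: G]) inE add1n ltnS; apply: subset_leq_card.
  apply/fintype.subsetP => w; rewrite !inE andbT => H.
  by apply: contraTneq H => ->; rewrite nextx (negPf eyy) (negPf exx).
have cardI : k < #|S :&: T|.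
  have := cardsUI S T; rewrite cardS -[#|T|]/(degr e x).
  by move: cardST deg_ge; clear; lia.
pose f w := [set w; next P w].
have [w /andP[wS wT] fw] : exists2 w, (w \in S) && (w \in T) & f w \notin F.
  apply/exists_inP; rewrite -negb_forall_in; apply: contraTN cardI => /forall_inP inF.
  rewrite -leqNgt (leq_trans _ szF) //.
  rewrite -(card_imset _ (next_edge_inj permP)) (leq_trans _ (card_size F)) //.
  apply: subset_leq_card; apply/fintype.subsetP => _ /imsetP[w wST ->].
  by apply: inF; move: wST; rewrite finset.inE.
have wx : w != x.
  by apply: contraTneq wT => ->; rewrite inE.
move: wS wT; rewrite !inE => yw xw.
have spl (q : seq G) : w \in q -> exists p1 p2, q = p1 ++ w :: p2.
  by move=> /splitPr[p1 p2]; exists p1, p2.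
have [p1 [p2 EP]] := spl _ (memP w).
case: p2 EP => [|z p2] EP.
  by move: wx; rewrite -last_s -[last y s]/(last y P) EP last_cat eqxx.
have nextw : next P w = z.
  rewrite -(next_rot (size p1) U) EP rot_size_cat /= eqxx //.
have [l El] : exists l, rcons p1 w = y :: l.
  by case: (p1) EP => [|a l] [<- _]; [exists [::]|exists (rcons l w)].
have lastl : last y l = w by rewrite -[LHS]/(last y (y :: l)) -El last_rcons.
have {}EP : P = (y :: l) ++ z :: p2 by rewrite EP -cat_rcons El.
have lastz : last z p2 = x by rewrite -last_s -[last y s]/(last y P) EP last_cat.
have [r Er] : exists r, rev (z :: p2) = x :: r.
  case: (lastP p2) lastz => [<-|q a]; first by exists [::].
  rewrite last_rcons => ->; exists (rcons (rev q) z).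
  by rewrite -rcons_cons rev_rcons rev_cons.
have lastr : last x r = z.
  by rewrite -[LHS]/(last x (x :: r)) -Er rev_cons last_rcons.
have : path e y l && path e z p2.
  by move: (pth : sorted e P); rewrite EP /= cat_path /= => /and3P[-> _ ->].
move=> /andP[pl pz].
have pr : path e x r.
  by rewrite -[path e x r]/(sorted e (x :: r)) -Er sorted_rev_sym.
(* The new cycle runs from [y] to [w], jumps to [x], returns to [z] and closes at [y]; of the path
   edges only wz is lost. *)
exists ((y :: l) ++ rev (z :: p2)); split.
- by rewrite -(permPr permP) EP perm_cat2l perm_rev.
- rewrite Er /= rcons_path cat_path pl /= lastl last_cat /= lastr pr andbT.
  by rewrite e_sym xw e_sym -nextw.
- have Uc : uniq ((y :: l) ++ rev (z :: p2)).
    by rewrite (perm_uniq (_ : perm_eq _ P)) // EP perm_cat2l perm_rev.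
  move=> a aF; apply: (sub_path_cycle_edges Uc); apply: sub_path_edges_cat.
  have := subF a aF; rewrite -/P EP path_edges_cat lastl path_edges_rev.
  rewrite !mem_cat inE mem_rev => /or3P[->//|/eqP aw|->]; last by rewrite orbT.
  by rewrite aw -nextw in aF; rewrite aF in fw.
Qed.

(** Removing the new edge from a Hamilton cycle that uses it leaves a Hamilton path between its
    ends. The path still contains [F], which avoids this edge, so [ham_path_close] applies. *)
Lemma ham_add_edge F k (u v : G) : irreflexive e -> size F <= k -> u != v ->
  ~~ e u v -> [set u; v] \notin F -> #|G| + k <= degr e u + degr e v ->
  ham_with (add_edge e u v) F -> ham_with e F.
Proof.
move=> e_irr szF uv euv uvF deg_ge [c [permc cyc subF]].
have U : uniq c by rewrite (perm_uniq permc) enum_uniq.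
have [cyc_e|] := boolP (cycle e c); first by exists c.
move=> not_cyc.
have [x xc xy] : exists2 x, x \in c & ~~ e x (next c x).
  apply/hasP; apply: contraR not_cyc => /hasPn none.
  by apply: cycle_from_next => // x /none; rewrite negbK.
have [i s E] := rot_to xc.
have permr : perm_eq (rot i c) (enum G) by rewrite perm_rot.
have sz : size (rot i c) = #|G| by rewrite size_rot (perm_size permc) -cardE.
have Ur : uniq (rot i c) by rewrite rot_uniq.
have cycr : cycle (add_edge e u v) (rot i c) by rewrite rot_cycle.
have subFr : {subset F <= cycle_edges (rot i c)}.
  by move=> a /subF; rewrite cycle_edges_rot // mem_rot.
move: xy; rewrite -(next_rot i U) E.
case: s E => [|y [|z s]] E; rewrite ?E in sz permr Ur cycr subFr *;
  move: (n_gt2); rewrite -?sz // => _.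
rewrite next_cons2 => exy.
move: cycr; rewrite /= /add_edge (negPf exy) /= => /and3P[/eqP xyuv yz pth].
have xyF : [set x; y] \notin F by rewrite xyuv.
have zs_y : y \notin z :: rcons s x.
  rewrite -rcons_cons mem_rcons in_cons negb_or.
  move: Ur => /= /andP[]; rewrite !inE !negb_or => /and3P[xy _ _] /andP[-> _].
  by rewrite eq_sym xy.
have eyz : e y z.
  case/orP: yz => // /eqP; rewrite -xyuv => /set2_eq[[yx zy]|[_ zx]].
    by move: zs_y; rewrite zy inE eqxx.
  by move: Ur; rewrite /= zx !inE eqxx orbT.
have pth_e : path e z (rcons s x).
  apply: (sub_in_path (P := predC1 y) _ _ pth).
  - move=> a b /[!inE] ay by_ /orP[//|/eqP]; rewrite -xyuv => /set2_eq[[_ E']|[E' _]].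
      by rewrite E' eqxx in by_.
    by rewrite E' eqxx in ay.
  - by apply/allP => a az; apply: contraNneq zs_y => <-.
have deg_xy : #|G| + k <= degr e x + degr e y.
  by move: xyuv => /set2_eq[[-> ->]|[-> ->]] //; rewrite addnC [degr e v + _]addnC addnC.
apply: (@ham_path_close F k x y (z :: rcons s x)) => //.
- by rewrite -(permPr permr) -rcons_cons -rcons_cons perm_rcons.
- by rewrite /= eyz.
- by rewrite /= last_rcons.
- move=> a aF; have := subFr a aF; rewrite cycle_edgesE //= inE => /orP[/eqP aE|//].
  by rewrite -aE aF in xyF.
- by rewrite e_irr.
- by rewrite e_irr.
Qed.

End Rotation.

(** Edges are added one at a time, each lowering the number of non-adjacent pairs. An added edge is
    never in [F], as the prescribed edges are already present. *)
Lemma closure_exists F k e : 2 < #|G| -> size F <= k -> symmetric e ->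
  irreflexive e -> (forall u v, [set u; v] \in F -> e u v) -> ~ ham_with e F ->
  exists e', [/\ symmetric e', irreflexive e', subrel e e', ~ ham_with e' F &
    forall u v, u != v -> ~~ e' u v -> degr e' u + degr e' v < #|G| + k].
Proof.
move=> n_gt2 szF; have [m] := ubnP #|[set p : G * G | ~~ e p.1 p.2]|.
elim: m e => // m IH e lt_m e_sym e_irr eF noham.
have [/existsP[u /existsP[v /and3P[uv euv deg_ge]]]|none] :=
  boolP [exists u, exists v, [&& u != v, ~~ e u v & #|G| + k <= degr e u + degr e v]].
  have uvF : [set u; v] \notin F by apply: contra euv; apply: eF.
  have sub_add : subrel e (add_edge e u v) by move=> x y; rewrite /add_edge => ->.
  have [|||||e' [H1 H2 H3 H4 H5]] := IH (add_edge e u v).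
  - rewrite -ltnS (leq_trans _ lt_m) // ltnS; apply: proper_card.
    apply/properP; split.
      apply/fintype.subsetP => p; rewrite !inE; apply: contra; exact: sub_add.
    by exists (u, v); rewrite !inE //= /add_edge eqxx orbT.
  - by move=> x y; rewrite /add_edge e_sym [[set x; y]]finset.setUC.
  - move=> x; rewrite /add_edge e_irr /=; apply/eqP => /set2_eq[[xu xv]|[xv xu]];
    by rewrite -xu -xv eqxx in uv.
  - by move=> x y /eF; apply: sub_add.
  - by move=> /(ham_add_edge e_sym n_gt2 e_irr szF uv euv uvF deg_ge).
  exists e'; split=> // x y xy; exact/H3/sub_add.
exists e; split=> // u v uv euv; rewrite ltnNge; apply: contra none => deg_ge.
by apply/existsP; exists u; apply/existsP; exists v; rewrite uv euv.
Qed.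

End Closure.

(** * Structure of closed graphs *)

Section NonNeighbours.
Variables (G : graph) (e : rel G).
Hypotheses (e_sym : symmetric e) (e_irr : irreflexive e).

(** #|nonnbr e u| is the quantity b(u) = n - 1 - deg(u) of the overview. *)
Definition nonnbr (e : rel G) (u : G) : {set G} := [set v | (v != u) && ~~ e u v].

Lemma card_nonnbr u : #|nonnbr e u| + degr e u + 1 = #|G|.
Proof.
have -> : #|G| = #|[set v | e u v] :|: (u |: nonnbr e u)|.
  rewrite -cardsT; apply: eq_card => v; rewrite !inE.
  by case: (v == u); rewrite /= ?orbT ?orbN.
rewrite cardsU cardsU1 !inE eqxx /= -/(degr e u).
have -> : [set v | e u v] :&: (u |: nonnbr e u) = finset.set0.
  apply/setP => v; rewrite !inE; case: eqP => [->|_] /=; first by rewrite e_irr.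
  by rewrite andbN.
by rewrite cards0 subn0; lia.
Qed.

Lemma nonnbr_sym u v : (v \in nonnbr e u) = (u \in nonnbr e v).
Proof. by rewrite !inE eq_sym e_sym. Qed.

Lemma sum_nonnbr (A B : {set G}) :
  \sum_(u in A) #|nonnbr e u :&: B| = \sum_(v in B) #|nonnbr e v :&: A|.
Proof.
have H u C : #|nonnbr e u :&: C| = \sum_(v in C) (v \in nonnbr e u).
  rewrite -sum1_card big_mkcond [RHS]big_mkcond /=; apply: eq_bigr => v _.
  by rewrite finset.in_setI; case: (v \in C); rewrite ?andbT ?andbF.
under eq_bigr do rewrite H.
under [RHS]eq_bigr do rewrite H.
rewrite exchange_big; apply: eq_bigr => v _; apply: eq_bigr => u _.
by rewrite nonnbr_sym.
Qed.

(* Non-edges between X and its complement are counted at both ends. *)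
Lemma double_count_nonnbr (X : {set G}) :
  2 * \sum_(x in X) #|nonnbr e x| + \sum_(w in ~: X) #|nonnbr e w :\: X| <=
  \sum_u #|nonnbr e u| + #|X| * #|X|.
Proof.
have -> : \sum_u #|nonnbr e u| = \sum_(x in X) #|nonnbr e x| +
    (\sum_(w in ~: X) #|nonnbr e w :\: X| + \sum_(x in X) #|nonnbr e x :&: ~: X|).
  rewrite -(sum_nonnbr (~: X) X) -big_split /= [LHS](bigID (mem X)) /=.
  congr (_ + _).
  apply: eq_big => [w|w _]; first by rewrite inE.
  by rewrite -(cardsID X) addnC.
have : \sum_(x in X) #|nonnbr e x| <=
    \sum_(x in X) #|nonnbr e x :&: ~: X| + #|X| * #|X|.
  rewrite -sum_nat_const -big_split /=; apply: leq_sum => x _.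
  rewrite -(cardsID X) addnC -finset.setDE leq_add2l.
  by apply: subset_leq_card; apply: subsetIr.
by clear; lia.
Qed.

End NonNeighbours.

(* With [s = delta - k], the graph is [H_graph] when [r = 0] and [L_graph] when
   [r = s - 1]. *)
Definition two_block (G : graph) (e : rel G) (k s : nat) (X Y : {set G}) (r : nat) :=
  [/\ #|X| = s, [disjoint X & Y],
      (forall u v, u \notin X -> v \notin X -> u != v -> e u v),
      (forall x w, x \in X -> w \notin X -> e x w = (w \in Y)) &
      (forall x, x \in X -> #|[set u in X | e x u]| = r) /\ #|Y| + r = k + s].

Section Structure.
Variables (G : graph) (e : rel G) (k s : nat).
Hypotheses (e_sym : symmetric e) (e_irr : irreflexive e).
Hypothesis n_large : (s + 1) * (k + 1 + 8 * s) + 32 * s * s + 2 * k + 16 * s + 2 <= #|G|.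
Hypothesis min_deg : forall v, k + s <= degr e v.
Hypothesis few_missing : \sum_u #|nonnbr e u| <= 2 * s * (#|G| - 1).
Hypothesis closed : forall u v, u != v -> ~~ e u v -> degr e u + degr e v < #|G| + k.

Let b u := #|nonnbr e u|.

Let pair u v : v \in nonnbr e u -> #|G| <= b u + b v + k + 1.
Proof.
rewrite inE eq_sym => /andP[uv euv]; have := closed uv euv.
have := card_nonnbr e_irr u; have := card_nonnbr e_irr v; rewrite -!/(b _).
by clear; lia.
Qed.

(** By [pair], two non-adjacent vertices cannot both lie outside [big]. Each member has about half
    of all vertices or more as non-neighbours, so [few_missing] bounds the size of [big]. *)
Let big := [set u | #|G| <= 2 * b u + k + 1].

Let card_big : #|big| <= 8 * s.
Proof.
have H : #|big| * (#|G| - k - 1) <= 2 * (2 * s * (#|G| - 1)).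
  apply: leq_trans (leq_mul (leqnn 2) few_missing).
  rewrite -sum_nat_const big_distrr /= [leqRHS](bigID (mem big)) /=.
  apply: leq_trans (leq_addr _ _); apply: leq_sum => u.
  by rewrite inE -subnDA leq_subLR [k + 1 + _]addnC addnA.
rewrite leqNgt; apply/negP => lt_big.
have : (8 * s + 1) * (#|G| - k - 1) <= 2 * (2 * s * (#|G| - 1)).
  by apply: leq_trans H; rewrite leq_mul // addn1.
have : 2 * s * (#|G| - 1) <= 2 * s * (2 * (#|G| - k - 1)).
  by rewrite leq_mul //; move: n_large; clear; lia.
by move: n_large; clear; nia.
Qed.

Let small_nonnbr u : (forall v, v \in nonnbr e u -> v \in big) -> b u <= 8 * s.
Proof.
by move=> H; apply: leq_trans card_big; apply: subset_leq_card; apply/fintype.subsetP.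
Qed.

Let b_small w : w \notin big -> b w <= 8 * s.
Proof.
move=> wb; apply: small_nonnbr => v wv; apply: contraLR (pair wv).
by move: wb; rewrite !inE -!ltnNge; clear; lia.
Qed.

(** By [pair], a vertex with a non-neighbour outside [big] falls in [X]; any other vertex has its
    non-neighbours in [big], hence at most 8 s of them. *)
Let X := [set u | #|G| <= b u + k + 1 + 8 * s].

Let b_out u : u \notin X -> b u <= 8 * s.
Proof.
move=> uX; apply: small_nonnbr => v uv; apply: contraLR uX => vb.
by rewrite negbK inE; have := pair uv; have := b_small vb; clear; lia.
Qed.

Let clique u v : u \notin X -> v \notin X -> u != v -> e u v.
Proof.
move=> uX vX uv; apply: contraT => euv.
have := @pair u v; rewrite inE eq_sym uv euv => /(_ isT).
by have := b_out uX; have := b_out vX; move: n_large; clear; lia.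
Qed.

(** With s + 1 vertices in [X], each having nearly all vertices as non-neighbours, counting at both
    ends would give about 2 (s + 1) n, beyond the 2 s (n - 1) allowed. *)
Let card_X : #|X| <= s.
Proof.
(* A crude bound comes first: it controls the error term #|X| * #|X| of the double count. *)
have le_X : #|X| <= 8 * s.
  apply: leq_trans card_big; apply: subset_leq_card; apply/fintype.subsetP => u.
  by rewrite !inE; move: n_large; clear; lia.
have H1 : #|X| * (#|G| - k - 1 - 8 * s) <= \sum_(x in X) #|nonnbr e x|.
  by rewrite -sum_nat_const; apply: leq_sum => u; rewrite inE /b; clear; lia.
have H2 := double_count_nonnbr e_sym X.
rewrite leqNgt; apply/negP => lt_sX.
have H3 : 2 * ((s + 1) * (#|G| - k - 1 - 8 * s)) <= 2 * s * (#|G| - 1) + 64 * s * s.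
  have : (s + 1) * (#|G| - k - 1 - 8 * s) <= #|X| * (#|G| - k - 1 - 8 * s).
    by rewrite leq_mul // addn1.
  have : #|X| * #|X| <= 8 * s * (8 * s) by rewrite leq_mul.
  have -> : 8 * s * (8 * s) = 64 * s * s by lia.
  have arith p p0 sx r t q m z : q <= z -> p0 <= p -> p <= sx -> 2 * sx + r <= t + q ->
    t <= m -> 2 * p0 <= m + z by clear; lia.
  by move=> HX Hp; apply: arith HX Hp H1 H2 few_missing.
by move: H3 n_large; clear; nia.
Qed.

Let nonnbr_out w : w \notin X -> nonnbr e w \subset X.
Proof.
move=> wX; apply/fintype.subsetP => v; rewrite inE eq_sym => /andP[wv].
by apply: contraR => vX; apply: clique.
Qed.

Let b_out_X w : w \notin X -> b w <= #|X|.
Proof. by move=> wX; apply: subset_leq_card; apply: nonnbr_out. Qed.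

(** [x] has a non-neighbour [w] outside [X], whose own non-neighbours all lie in [X]. Then [pair]
    gives deg(x) <= k + b(w) <= k + #|X| <= k + s, and [min_deg] makes these equalities. *)
Let X_deg x : x \in X -> #|X| = s /\ degr e x = k + s.
Proof.
move=> xX; have bx := xX; rewrite inE in bx.
have [w xw wX] : exists2 w, w \in nonnbr e x & w \notin X.
  apply/exists_inP; rewrite -negb_forall_in; apply/negP => /forall_inP H.
  have : b x <= #|X| by apply: subset_leq_card; apply/fintype.subsetP.
  by move: card_X bx n_large; clear; lia.
have := pair xw; have := b_out_X wX; have := min_deg x.
have := card_nonnbr e_irr x; move: card_X; rewrite -/(b x).
by clear; lia.
Qed.

(** A vertex [w] adjacent to some [x] in [X] has b(w) < s, so by [pair] a non-neighbour of [w] in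
    [X] would have degree below k + s. *)
Let join_all x w : x \in X -> w \notin X -> e x w -> forall x', x' \in X -> e x' w.
Proof.
move=> xX wX exw x' x'X; apply: contraT => nex'w.
have bw : b w < #|X|.
  apply: proper_card; apply/properP; split; first exact: nonnbr_out.
  by exists x; rewrite // inE e_sym exw andbF.
have := @pair x' w; rewrite inE nex'w.
have -> : w != x' by apply: contraNneq wX => ->.
move=> /(_ isT); have [] := X_deg x'X.
have := card_nonnbr e_irr x'; move: bw; rewrite -/(b x').
by clear; lia.
Qed.

Lemma closed_structure :
  (forall u v, u != v -> e u v) \/ exists X Y r, two_block e k s X Y r.
Proof.
have [X0|[x0 x0X]] := set_0Vmem X.
  by left=> u v; apply: clique; rewrite X0 inE.
right; pose Y := [set w | (w \notin X) && e x0 w].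
have memY x w : x \in X -> w \notin X -> e x w = (w \in Y).
  by move=> xX wX; rewrite inE wX; apply/idP/idP => H; apply: join_all H _ _.
have degX x : x \in X -> #|[set u in X | e x u]| + #|Y| = k + s.
  move=> xX; have [_ <-] := X_deg xX.
  rewrite /degr -[RHS](cardsID X); congr (_ + _).
    by apply: eq_card => u; rewrite !inE andbC.
  apply: eq_card => u; rewrite finset.in_setD [in RHS]inE.
  have [uX|uX] /= := boolP (u \in X); first by rewrite inE uX.
  by rewrite memY.
exists X, Y, (k + s - #|Y|); split=> //.
- by have [] := X_deg x0X.
- rewrite disjoint_subset; apply/fintype.subsetP => u uX.
  by change (u \notin Y); rewrite inE uX.
- split=> [x /degX <-|]; first by rewrite addnK.
  by rewrite subnKC // -(degX x0 x0X) leq_addl.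
Qed.

End Structure.

Lemma degr_sub (G : graph) (e e' : rel G) v : subrel e e' -> degr e v <= degr e' v.
Proof.
move=> sub; apply: subset_leq_card; apply/fintype.subsetP => w; rewrite !inE.
exact: sub.
Qed.

Lemma degr_two_block (G : graph) (e : rel G) k s X Y r x :
  two_block e k s X Y r -> x \in X -> degr e x = k + s.
Proof.
move=> [_ disj _ XY [reg <-]] xX; rewrite -(reg x xX) addnC.
rewrite /degr -[LHS](cardsID X); congr (_ + _).
  by apply: eq_card => u; rewrite !inE andbC.
apply: eq_card => u; rewrite !inE.
by have [uX|uX] /= := boolP (u \in X); [rewrite (disjointFr disj) | rewrite XY].
Qed.

(** * Block structure forced by a non-extendable path system *)

Section NonHamiltonian.
Variables (G : graph) (k s : nat).
Hypothesis s_ge2 : 2 <= s.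
Hypothesis n_large : (s + 1) * (k + 1 + 8 * s) + 32 * s * s + 2 * k + 16 * s + 2 <= #|G|.
Hypothesis min_deg : forall v : G, k + s <= degr adj v.
Hypothesis few_missing : \sum_(u : G) #|nonnbr adj u| <= 2 * s * (#|G| - 1).

Let n_gt2 : 2 < #|G|.
Proof. by move: n_large s_ge2; clear; nia. Qed.

Lemma path_edges_adj (e : rel G) p u v : symmetric e -> sorted e p ->
  [set u; v] \in path_edges p -> e u v.
Proof.
move=> e_sym; case: p => [|x p] //=; elim: p x => [|y p IH] x //= /andP[exy pth].
rewrite inE => /orP[/eqP/set2_eq[[-> ->]|[-> ->]] //|]; first by rewrite e_sym.
exact: IH.
Qed.

(** The closed graph is not complete by [ham_complete], and [ham_regular] rules out 0 < r < s -
    1. *)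
Lemma nonham_two_block (ps : seq (seq G)) :
  all (@is_path G) ps -> uniq (flatten ps) ->
  \sum_(p <- ps) size (path_edges p) <= k ->
  ~ (exists2 c : seq G, hamilton_cycle c &
      forall p, p \in ps -> {subset path_edges p <= cycle_edges c}) ->
  exists (e : rel G) X Y r,
    [/\ subrel adj e, symmetric e, two_block e k s X Y r & r = 0 \/ r + 1 = s].
Proof.
move=> paths U le_k nonham; pose F := flatten (map (@path_edges G) ps).
have szF : size F <= k.
  by rewrite /F size_flatten /shape -map_comp sumnE big_map.
have noF : ~ ham_with adj F.
  move=> [c [permc cyc subF]]; apply: nonham; exists c.
    rewrite /hamilton_cycle (perm_size permc) -cardE n_gt2 (perm_uniq permc).
    rewrite enum_uniq cyc; apply/forallP => x; by rewrite (perm_mem permc) mem_enum.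
  by move=> p pp a ap; apply: subF; apply/flattenP; exists (path_edges p) => //; apply: map_f.
have adjF u v : [set u; v] \in F -> adj u v.
  move=> /flattenP[_ /mapP[p pp ->]]; apply: path_edges_adj; first exact: adj_sym.
  by have /and3P[] := allP paths _ pp.
have [e [e_sym e_irr sub_e noe closed]] :=
  closure_exists n_gt2 szF (@adj_sym G) (@adj_irr G) adjF noF.
have pps : all (path_of e) ps.
  apply/allP => p /(allP paths)/and3P[pn _ sp]; rewrite /path_of pn.
  by case: (p) sp => //= x q; apply: sub_path.
have deg_e v : k + s <= degr e v by apply: leq_trans (min_deg v) (degr_sub _ sub_e).
have few_e : \sum_u #|nonnbr e u| <= 2 * s * (#|G| - 1).
  apply: leq_trans few_missing; apply: leq_sum => u _; apply: subset_leq_card.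
  apply/fintype.subsetP => v; rewrite !inE => /andP[->]; apply: contra; exact: sub_e.
have [complete|[X [Y [r blk]]]] :=
  closed_structure e_sym e_irr n_large deg_e few_e closed.
  case: noe; apply: (ham_complete n_gt2 pps U _ (erefl finset.set0)) => u v _ _.
  exact: complete.
exists e, X, Y, r; split=> //.
have [cardX disj clique XY [reg cardY]] := blk.
have [r0|r_gt0] := posnP r; first by left.
right; apply/eqP; apply: contraT => ne_r.
have lt_r : r < s.
  have /card_gt0P[x xX] : 0 < #|X| by rewrite cardX; apply: leq_trans s_ge2.
  rewrite -(reg x xX) -cardX; apply: proper_card; apply/properP; split.
    by apply/fintype.subsetP => u; rewrite inE => /andP[].
  by exists x; rewrite // inE e_irr andbF.
case: noe; apply: (@ham_regular G e e_sym e_irr n_gt2 ps k X pps U le_k clique Y r) => //.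
- by move=> x y xX yY; rewrite XY // (disjointFl disj).
- by rewrite cardX.
- by rewrite cardX; move: lt_r ne_r; clear; lia.
Qed.

(* Degrees force [G] to keep every edge of the closed supergraph at [X]. *)
Lemma two_block_spanning (e : rel G) X Y r :
  subrel adj e -> symmetric e -> two_block e k s X Y r ->
  [/\ forall x u, x \in X -> adj x u = e x u &
      \sum_(w in ~: X) #|nonnbr adj w :\: X| <= 2 * s * (k + s) + s * s].
Proof.
move=> sub e_sym blk; have [cardX disj clique XY [reg cardY]] := blk.
have deg_x x : x \in X -> degr adj x = k + s.
  move=> xX; apply/eqP; rewrite eqn_leq min_deg andbT.
  by rewrite -(degr_two_block blk xX) degr_sub.
split=> [x u xX|].
  have : [set w | adj x w] = [set w | e x w].
    apply/eqP; rewrite eqEcard; apply/andP; split.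
      by apply/fintype.subsetP => w; rewrite !inE; apply: sub.
    by rewrite -!/(degr _ _) (degr_two_block blk xX) deg_x.
  by move/setP/(_ u); rewrite !inE.
have := double_count_nonnbr (@adj_sym G) X.
(* The vertices of [X] already account for 2 s (n - 1 - k - s) of the at most 2 s (n - 1) + s^2 in
   the double count, which leaves a bound free of n. *)
have -> : \sum_(x in X) #|nonnbr adj x| = s * (#|G| - 1 - (k + s)).
  rewrite -{1}cardX -sum_nat_const; apply: eq_bigr => x xX.
  have := card_nonnbr (@adj_irr G) x; rewrite deg_x //.
  by move: #|nonnbr adj x| #|G|; clear; lia.
rewrite cardX; move: few_missing n_large.
move: (\sum_u _) (\sum_(w in _) _) #|G|; clear.
move=> a b n Ha Hn.
have -> : 2 * (s * (n - 1 - (k + s))) = 2 * s * (n - 1) - 2 * s * (k + s) by nia.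
have : 2 * s * (k + s) <= 2 * s * (n - 1) by nia.
by clear Hn; lia.
Qed.

End NonHamiltonian.

(** * Spectral bounds *)

Section Spectrum.
Local Open Scope ring_scope.
Variable R : realType.

Lemma poly_roots_finite (p : {poly R}) : p != 0 ->
  exists rs : seq R, forall x, root p x -> x \in rs.
Proof.
have [m] := ubnP (size p); elim: m p => // m IH p lt_m p0.
have [[x px]|none] := boolp.pselect (exists x, root p x); last first.
  by exists [::] => x px; case: none; exists x.
have /factor_theorem [q pq] := px.
have q0 : q != 0 by apply: contraNneq p0 => q0; rewrite pq q0 mul0r.
have [|rs rsP] := IH q _ q0.
  by move: lt_m; rewrite pq size_Mmonic ?monicXsubC // size_XsubC addn2.
exists (x :: rs) => y; rewrite pq rootM root_XsubC inE.
by move=> /orP[/rsP ->|->]; rewrite ?orbT.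
Qed.

Lemma signless_radius_attained (G : graph) (c : R) : 0 < c ->
  c <= signless_radius R G ->
  exists2 a, eigenvalue (signless_laplacian R G) a & c <= a.
Proof.
move=> c_gt0 le_c; apply: boolp.contrapT => none.
have lt_c a : eigenvalue (signless_laplacian R G) a -> a < c.
  by move=> ea; rewrite ltNge; apply/negP => le_ca; apply: none; exists a.
have [rs rsP] := poly_roots_finite (monic_neq0 (char_poly_monic (signless_laplacian R G))).
(* The default 0 of this maximum and the value 0 of the supremum of the empty set both lie below
   [c]. *)
pose m := \big[Num.max/0]_(a <- rs | eigenvalue (signless_laplacian R G) a) a.
have lt_m : m < c by apply: bigmax_lt.
move: le_c; rewrite leNgt => /negP; apply; apply: le_lt_trans lt_m.
have [[a0 ea0]|empty] := boolp.pselect (exists a, eigenvalue (signless_laplacian R G) a).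
  apply: ge_sup; first by exists a0.
  move=> a ea; apply: (@le_bigmax_seq _ _ _ _ 0 a _ id) => //.
  by apply: rsP; rewrite -eigenvalue_root_char.
rewrite /signless_radius; set E := (X in sup X).
have -> : E = classical_sets.set0.
  by apply/classical_sets.seteqP; split=> // a ea; apply: empty; exists a.
by rewrite sup0; apply: bigmax_ge_id.
Qed.

Definition eigenfunction (G : graph) (a : R) (f : G -> R) :=
  forall v, a * f v = (degr adj v)%:R * f v + \sum_(u | adj v u) f u.

Lemma eigenvalue_fun (G : graph) (a : R) :
  eigenvalue (signless_laplacian R G) a ->
  exists2 f : G -> R, eigenfunction a f & exists v, f v != 0.
Proof.
move=> /eigenvalueP[x xQ x0].
exists (fun v => x 0 (enum_rank v)); last first.
  apply: boolp.contrapT => none; case/eqP: x0; apply/rowP => j; rewrite mxE.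
  apply/eqP/negPn/negP => xj; apply: none; exists (enum_val j).
  by rewrite enum_valK.
move=> v; have := congr1 (fun y : 'rV_ _ => y 0 (enum_rank v)) xQ.
rewrite mulmxDr !mxE => <-; congr (_ + _).
  rewrite (bigD1 (enum_rank v)) //= !mxE eqxx enum_rankK mulrC big1 ?addr0 //.
  by move=> i /negPf iv; rewrite !mxE iv mulr0n mulr0.
rewrite [RHS]big_mkcond (reindex enum_rank) /=; last first.
  by apply: onW_bij; exists enum_val; [apply: enum_rankK|apply: enum_valK].
apply: eq_bigr => u _; rewrite mxE !enum_rankK adj_sym.
by case: (adj v u); rewrite ?mulr1 ?mulr0.
Qed.

End Spectrum.

(** * Edge count from the spectral hypothesis *)

Section EdgeBound.
Variables (G : graph).
Let n := #|G|.

Lemma big_nonnbr (T : Type) (idx : T) (op : Monoid.com_law idx) (v : G) (F : G -> T) :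
  \big[op/idx]_u F u = op (op (\big[op/idx]_(u | adj v u) F u) (F v))
                          (\big[op/idx]_(u in nonnbr adj v) F u).
Proof.
rewrite (bigID (adj v)) /= -Monoid.mulmA; congr (op _ _).
rewrite (bigD1 v) /=; last by rewrite adj_irr.
by congr (op _ _); apply: eq_bigl => u; rewrite inE andbC.
Qed.

(** With d = deg(v) and b = b(v), the hypothesis bounds the sum of b(u) over the neighbours of [v]
    by d (2 s - b). Non-neighbours have degree at least 1, so they contribute at most b (n - 2).
    With b itself, the total is at most 2 s (n - 1) - b (2 s - b). *)
Lemma edge_bound_nat (s : nat) (v : G) : (forall u : G, 0 < degr adj u) ->
  2 * (n - s - 1) * degr adj v <= degr adj v * degr adj v + \sum_(u | adj v u) degr adj u ->
  \sum_(u : G) #|nonnbr adj u| <= 2 * s * (n - 1).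
Proof.
move=> deg_gt0 H; rewrite (big_nonnbr _ v) /=.
have E1 : \sum_(u | adj v u) degr adj u + \sum_(u | adj v u) #|nonnbr adj u| =
    degr adj v * (n - 1).
  rewrite -big_split /= /degr -sum1_card big_distrl /=.
  apply: eq_big => [u|u _]; first by rewrite inE.
  by have := card_nonnbr (@adj_irr G) u; rewrite /degr -/n; clear; lia.
have E2 : \sum_(u in nonnbr adj v) #|nonnbr adj u| <= #|nonnbr adj v| * (n - 2).
  rewrite -sum_nat_const; apply: leq_sum => u _.
  by have := card_nonnbr (@adj_irr G) u; have := deg_gt0 u; rewrite -/n; clear; lia.
have E3 := card_nonnbr (@adj_irr G) v; have d_gt0 := deg_gt0 v.
move: E3 E1 E2 H d_gt0; rewrite -/n.
move: #|nonnbr adj v| (degr adj v) (\sum_(u | adj v u) degr adj u)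
  (\sum_(u | adj v u) #|nonnbr adj u|) (\sum_(u in nonnbr adj v) _) n; clear.
move=> b d A B C m E3 E1 E2 H d_gt0.
(* For b > 2 s the bound d (2 s - b) on a sum of naturals would be negative. Below, j stands for 2 s
   - b. *)
have [b2s|b2s] := leqP b (2 * s); last by nia.
have : B + 2 * (m - s - 1) * d <= d * d + d * (m - 1) by nia.
have [j sj] : exists j, 2 * s = b + j by exists (2 * s - b); lia.
have mE : m = b + d + 1 by lia.
have -> : 2 * (m - s - 1) = 2 * d + b - j by lia.
have m1 : m - 1 = b + d by lia.
have m2 : m - 2 = b + d - 1 by lia.
rewrite sj m1 => HB; rewrite m1 in E1; rewrite m2 in E2.
have B_le : B <= j * d.
  have [le_j|lt_j] := leqP j (2 * d + b).
    have [i Ei] : exists i, 2 * d + b = j + i by exists (2 * d + b - j); lia.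
    move: HB; rewrite Ei addKn => HB.
    have : j * d + i * d = 2 * d * d + b * d by rewrite -mulnDl -Ei mulnDl.
    by lia.
  have : (2 * d + b) * d <= j * d by rewrite leq_mul // ltnW.
  by lia.
have C_le : b + C <= b * (b + d).
  have -> : b * (b + d) = b + b * (b + d - 1); last by rewrite leq_add2l.
  by rewrite -mulnS; congr (_ * _); lia.
have : (b + j) * (b + d) = b * (b + d) + j * b + j * d by rewrite mulnDl !mulnDr addnA.
by lia.
Qed.

Local Open Scope ring_scope.

(* Evaluate the eigenvalue equation at a vertex maximizing [|f v| / deg v]. *)
Lemma edge_bound (R : realType) (s : nat) (a : R) (f : G -> R) :
  (forall u : G, (0 < degr adj u)%N) -> eigenfunction a f ->
  (exists v, f v != 0) -> (2 * (n - s - 1))%:R <= a ->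
  (\sum_(u : G) #|nonnbr adj u| <= 2 * s * (n - 1))%N.
Proof.
move=> deg_gt0 ef [v0 fv0] le_a.
pose g v := `|f v| / (degr adj v)%:R.
have d_gt0 (v : G) : 0 < (degr adj v)%:R :> R. by rewrite ltr0n.
have [v _ maxv] := @Order.TotalTheory.arg_maxP _ R G v0 predT g isT.
have gE u : `|f u| = g u * (degr adj u)%:R by rewrite /g divfK ?gt_eqF.
have gv_gt0 : 0 < g v.
  by apply: lt_le_trans (maxv v0 isT); rewrite divr_gt0 ?normr_gt0.
apply: (@edge_bound_nat s v deg_gt0).
rewrite -(ler_nat R) natrD !natrM.
have H : (a - (degr adj v)%:R) * `|f v| <= \sum_(u | adj v u) `|f u|.
  have : (a - (degr adj v)%:R) * f v = \sum_(u | adj v u) f u.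
    by rewrite mulrBl ef addrAC subrr add0r.
  move=> /(congr1 (fun x => `|x|)); rewrite normrM => E.
  apply: (@le_trans _ _ (`|a - (degr adj v)%:R| * `|f v|)).
    by rewrite ler_wpM2r // ler_norm.
  by rewrite E ler_norm_sum.
have H2 : \sum_(u | adj v u) `|f u| <= g v * (\sum_(u | adj v u) degr adj u)%:R.
  rewrite natr_sum mulr_sumr; apply: ler_sum => u _.
  by rewrite gE ler_wpM2r //; apply: maxv.
have : (a - (degr adj v)%:R) * (degr adj v)%:R <= (\sum_(u | adj v u) degr adj u)%:R.
  rewrite -(ler_pM2l gv_gt0) (le_trans _ (le_trans H H2)) //.
  by rewrite gE mulrCA.
rewrite mulrBl lerBlDl; apply: le_trans.
by rewrite -natrM ler_wpM2r // ltW.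
Qed.

End EdgeBound.

(** * Quadratic form and missing edges *)

Section MissingEdges.
Local Open Scope ring_scope.
Variables (R : realType) (G : graph) (X : {set G}) (a : R) (f : G -> R).
Let n := #|G|.
Let s := #|X|.
Let W := ~: X.

(** The pairs are ordered: every missing edge outside [X] counts twice, whereas [crossing_pairs]
    counts each edge leaving [X] once. *)
Definition missing_pairs (X : {set G}) : nat :=
  \sum_(w in ~: X) #|nonnbr adj w :\: X|.

Definition crossing_pairs (X : {set G}) : nat :=
  \sum_(x in X) #|[set w in ~: X | adj x w]|.

Hypothesis ef : eigenfunction a f.

(** The form of D + A is the sum of (f u + f v)^2 over the edges; the double sum meets each edge in
    both orders, hence the factor 2. *)
Lemma rayleigh : 2 * a * (\sum_v f v ^+ 2) =
  \sum_u \sum_v (adj u v)%:R * (f u + f v) ^+ 2.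
Proof.
have expand : \sum_u \sum_v (adj u v)%:R * (f u + f v) ^+ 2 =
    2 * (\sum_u (degr adj u)%:R * f u ^+ 2) +
    2 * (\sum_u f u * \sum_(v | adj u v) f v).
  have dE u : (degr adj u)%:R * f u ^+ 2 = \sum_v (adj u v)%:R * f u ^+ 2 :> R.
    rewrite -mulr_suml -natr_sum; congr (_%:R * _).
    by rewrite /degr -sum1_card big_mkcond; apply: eq_bigr => v _; rewrite inE.
  have sE u : f u * \sum_(v | adj u v) f v = \sum_v (adj u v)%:R * (f u * f v).
    rewrite mulr_sumr big_mkcond; apply: eq_bigr => v _.
    by case: (adj u v); rewrite ?mul1r ?mul0r.
  under [in RHS]eq_bigr => u _ do rewrite dE.
  under [X in _ = _ + 2 * X]eq_bigr => u _ do rewrite sE.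
  have swap : \sum_u \sum_v (adj u v)%:R * f u ^+ 2 =
      \sum_u \sum_v (adj u v)%:R * f v ^+ 2.
    by rewrite exchange_big; apply: eq_bigr => u _; apply: eq_bigr => v _; rewrite adj_sym.
  rewrite mulr_natl mulr2n {2}swap mulr_sumr -!big_split /=.
  apply: eq_bigr => u _; rewrite mulr_sumr -!big_split /=.
  by apply: eq_bigr => v _; ring.
rewrite expand -mulrDr -mulrA; congr (2 * _).
rewrite mulr_sumr -big_split /=; apply: eq_bigr => u _.
by rewrite expr2 mulrA ef mulrDl; ring.
Qed.

Let outside u v := (u \notin X) && (v \notin X) && (v != u).

Lemma missing_pairsE :
  missing_pairs X = (\sum_u \sum_v (outside u v && ~~ adj u v))%N.
Proof.
rewrite /missing_pairs big_mkcond; apply: eq_bigr => u _; rewrite inE.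
rewrite /outside; case: (u \in X) => /=; first by rewrite big1.
rewrite -sum1_card big_mkcond; apply: eq_bigr => v _.
by rewrite finset.in_setD inE; case: (v \in X) => //=; case: (v == u); case: (adj u v).
Qed.

Lemma crossing_pairsE :
  crossing_pairs X = (\sum_u \sum_v [&& u \in X, v \notin X & adj u v])%N.
Proof.
rewrite /crossing_pairs big_mkcond; apply: eq_bigr => u _.
case: (u \in X) => /=; last by rewrite big1.
rewrite -sum1_card big_mkcond; apply: eq_bigr => v _.
by rewrite !inE; case: (v \in X); case: (adj u v).
Qed.

Lemma crossing_pairsE' :
  crossing_pairs X = (\sum_u \sum_v [&& u \notin X, v \in X & adj u v])%N.
Proof.
rewrite crossing_pairsE exchange_big; apply: eq_bigr => u _; apply: eq_bigr => v _.
by rewrite adj_sym; case: (u \in X); case: (v \in X).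
Qed.

Lemma sum_outside : \sum_u \sum_v (outside u v)%:R * (2 * f u ^+ 2 + 2 * f v ^+ 2) =
  4 * (n - s - 1)%:R * \sum_(u in W) f u ^+ 2.
Proof.
have cnt u : \sum_v (outside u v)%:R * f u ^+ 2 =
    (u \in W)%:R * ((n - s - 1)%:R * f u ^+ 2).
  rewrite -mulr_suml -natr_sum /outside inE.
  case: (boolP (u \in X)) => uX /=; first by rewrite big1 ?mul0r.
  rewrite mul1r; congr (_%:R * _).
  rewrite -[RHS]/((n - #|X| - 1)%N) -(_ : #|W :\ u| = (n - #|X| - 1)%N).
    by rewrite -sum1_card [RHS]big_mkcond; apply: eq_bigr => v _; rewrite !inE andbC.
  have := cardsD1 u W; rewrite inE uX /= => E.
  have := cardsC X; rewrite -/W -/n; move: E; clear; lia.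
have H : \sum_u \sum_v (outside u v)%:R * f u ^+ 2 =
    (n - s - 1)%:R * \sum_(u in W) f u ^+ 2.
  rewrite mulr_sumr [RHS]big_mkcond; apply: eq_bigr => u _; rewrite cnt.
  by case: (u \in W); rewrite ?mul1r ?mul0r.
have swap : \sum_u \sum_v (outside u v)%:R * f v ^+ 2 =
    \sum_u \sum_v (outside u v)%:R * f u ^+ 2.
  rewrite exchange_big; apply: eq_bigr => u _; apply: eq_bigr => v _.
  by rewrite /outside eq_sym [(v \notin X) && _]andbC.
have -> : 4 * (n - s - 1)%:R * \sum_(u in W) f u ^+ 2 =
  2 * (\sum_u \sum_v (outside u v)%:R * f u ^+ 2) +
  2 * (\sum_u \sum_v (outside u v)%:R * f v ^+ 2) by rewrite swap H; ring.
rewrite !mulr_sumr -big_split; apply: eq_bigr => u _.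
rewrite !mulr_sumr -big_split; apply: eq_bigr => v _ /=; ring.
Qed.

(* Compare the quadratic form termwise with that of the clique on the
   complement of X, whose spectral radius is [2 * (n - s - 1)]. *)
Lemma quadratic_bound (eta : R) : 0 <= eta -> eta <= 1 ->
  (forall x, x \in X -> `|f x| <= eta) ->
  (forall w, w \notin X -> 1 - eta <= f w <= 1) ->
  (2 * (n - s - 1))%:R <= a ->
  4 * (1 - eta) ^+ 2 * (missing_pairs X)%:R <=
    2 * (1 + eta) ^+ 2 * (crossing_pairs X)%:R + 4 * eta ^+ 2 * (s * s)%:R.
Proof.
move=> eta0 eta1 fX fW le_a.
(* Outside [X], (x + y)^2 <= 2 x^2 + 2 y^2 compares with the clique, and a missing pair saves at
   least 4 (1 - eta)^2. Pairs with one or two vertices in [X] contribute at most (1 + eta)^2 and (2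
   eta)^2. *)
have term u v : (adj u v)%:R * (f u + f v) ^+ 2 <=
    (outside u v)%:R * (2 * f u ^+ 2 + 2 * f v ^+ 2)
    - 4 * (1 - eta) ^+ 2 * (outside u v && ~~ adj u v)%:R
    + (1 + eta) ^+ 2 * [&& u \in X, v \notin X & adj u v]%:R
    + (1 + eta) ^+ 2 * [&& u \notin X, v \in X & adj u v]%:R
    + 4 * eta ^+ 2 * ((u \in X) && (v \in X))%:R.
  have sq t c : - c <= t -> t <= c -> t ^+ 2 <= c ^+ 2 :> R by nra.
  have simp := (mulr1n, mulr0n, mul0r, mul1r, mulr0, mulr1, oppr0, addr0, add0r).
  have e1 := sqr_ge0 (1 + eta); have e2 := sqr_ge0 eta.
  rewrite /outside.
  have [uX|uX] := boolP (u \in X); have [vX|vX] := boolP (v \in X).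
  - have := fX _ uX; have := fX _ vX; rewrite !ler_norml => /andP[v1 v2] /andP[u1 u2].
    case: (adj u v); rewrite /= !simp; last by rewrite mulr_ge0.
    have -> : 4 * eta ^+ 2 = (2 * eta) ^+ 2 by ring.
    by apply: sq; lra.
  - have := fX _ uX; rewrite ler_norml => /andP[u1 u2]; have /andP[v1 v2] := fW _ vX.
    by case: (adj u v); rewrite /= !simp //; apply: sq; lra.
  - have := fX _ vX; rewrite ler_norml => /andP[v1 v2]; have /andP[u1 u2] := fW _ uX.
    by case: (adj u v); rewrite /= !simp //; apply: sq; lra.
  - have [->|vu] := eqVneq v u; first by rewrite adj_irr /= !simp.
    have /andP[u1 u2] := fW _ uX; have /andP[v1 v2] := fW _ vX.
    case: (adj u v); rewrite /= !simp; first by have := sqr_ge0 (f u - f v); lra.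
    have : (1 - eta) ^+ 2 <= f u ^+ 2 by nra.
    have : (1 - eta) ^+ 2 <= f v ^+ 2 by nra.
    by lra.
have sumM (F : G -> G -> nat) c : \sum_u \sum_v c * (F u v)%:R =
    c * ((\sum_u \sum_v F u v)%N)%:R :> R.
  rewrite natr_sum mulr_sumr; apply: eq_bigr => u _.
  by rewrite natr_sum mulr_sumr.
have H : \sum_u \sum_v (adj u v)%:R * (f u + f v) ^+ 2 <= \sum_u \sum_v
    ((outside u v)%:R * (2 * f u ^+ 2 + 2 * f v ^+ 2)
    - 4 * (1 - eta) ^+ 2 * (outside u v && ~~ adj u v)%:R
    + (1 + eta) ^+ 2 * [&& u \in X, v \notin X & adj u v]%:R
    + (1 + eta) ^+ 2 * [&& u \notin X, v \in X & adj u v]%:R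
    + 4 * eta ^+ 2 * ((u \in X) && (v \in X))%:R).
  by apply: ler_sum => u _; apply: ler_sum => v _.
move: H; rewrite -rayleigh.
under [X in _ <= X]eq_bigr => u _ do rewrite !big_split /= sumrN.
rewrite !big_split /= sumrN !sumM -missing_pairsE -crossing_pairsE -crossing_pairsE'.
rewrite sum_outside => H.
have XX : (\sum_u \sum_v ((u \in X) && (v \in X)) = s * s)%N.
  rewrite /s -{1}sum1_card big_distrl /= [RHS]big_mkcond; apply: eq_bigr => u _.
  case: (u \in X) => /=; last by rewrite big1.
  by rewrite mul1n -sum1_card [RHS]big_mkcond; apply: eq_bigr => v _; case: (v \in X).
rewrite XX in H.
(* The clique terms are absorbed by the left-hand side, because a is at least the spectral radius of
   the clique. *)
have : 4 * (n - s - 1)%:R * (\sum_(u in W) f u ^+ 2) <= 2 * a * \sum_v f v ^+ 2.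
  apply: (@le_trans _ _ (2 * a * \sum_(u in W) f u ^+ 2)).
    rewrite ler_wpM2r //; first by apply: sumr_ge0 => u _; apply: sqr_ge0.
    by move: le_a; rewrite natrM; lra.
  rewrite ler_wpM2l //; first by have := le_trans (ler0n _ _) le_a; lra.
  rewrite [leRHS](bigID (mem W)) /= lerDl; apply: sumr_ge0 => u _; apply: sqr_ge0.
by lra.
Qed.

End MissingEdges.

(** * Entries of a normalized eigenvector *)

Section EigenEstimates.
Local Open Scope ring_scope.
Variables (R : realType) (G : graph) (X : {set G}) (a : R) (f : G -> R).
Variables (delta C K : nat) (u0 : G).
Let n := #|G|.
Let s := #|X|.
Hypothesis ef : eigenfunction a f.
Hypothesis fu0 : f u0 = 1.
Hypothesis f_le1 : forall u, `|f u| <= 1.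
Hypothesis le_a : (2 * (n - s - 1))%:R <= a.
Hypothesis delta_gt0 : (0 < delta)%N.
Hypothesis degX : forall x, x \in X -> (degr adj x <= delta)%N.
Hypothesis nonnbrW : forall w, w \notin X -> (#|nonnbr adj w| + 1 <= C)%N.
Hypothesis n_large : (2 * s + 3 + delta + K * delta + 3 * C * K <= n)%N.

Lemma sum_le_card (P : {set G}) : `|\sum_(u in P) f u| <= #|P|%:R.
Proof.
apply: le_trans (ler_norm_sum _ _ _) _; rewrite -sum1_card natr_sum.
by apply: ler_sum => u _.
Qed.

Let SE v : \sum_(u | adj v u) f u = \sum_u f u - f v - \sum_(u in nonnbr adj v) f u.
Proof. by rewrite (big_nonnbr _ v) /=; ring. Qed.

Let deg_sum v : `|\sum_(u | adj v u) f u| <= (degr adj v)%:R.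
Proof.
have -> : \sum_(u | adj v u) f u = \sum_(u in [set u | adj v u]) f u.
  by apply: eq_bigl => u; rewrite inE.
exact: sum_le_card.
Qed.

Let a_large : (2 * n)%:R - (2 * s)%:R - 2 <= a.
Proof.
apply: le_trans le_a; rewrite -[2]/(2%:R) -!natrB; [|lia|lia].
by rewrite ler_nat; lia.
Qed.

Let n_largeR : 2 * s%:R + 3 + delta%:R + K%:R * delta%:R + 3 * C%:R * K%:R <= n%:R :> R.
Proof. by rewrite -!natrM -!natrD ler_nat. Qed.

(** A vertex of [X] has at most [delta] neighbours, with values at most 1 in modulus, while a is at
    least about 2 n. *)
Lemma eigen_small x : x \in X -> K%:R * `|f x| <= 1.
Proof.
move=> xX; have dx : (degr adj x)%:R <= delta%:R :> R by rewrite ler_nat degX.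
have : (a - delta%:R) * `|f x| <= delta%:R.
  have : (a - (degr adj x)%:R) * f x = \sum_(u | adj x u) f u.
    by rewrite mulrBl ef addrAC subrr add0r.
  move=> /(congr1 (fun z => `|z|)); rewrite normrM => E.
  have := deg_sum x; rewrite -E => H.
  apply: le_trans (dx); apply: le_trans H; rewrite ler_wpM2r //.
  by apply: le_trans (ler_norm _); rewrite lerB.
have : K%:R * delta%:R <= a - delta%:R.
  move: a_large n_largeR; rewrite !natrM.
  have : 0 <= C%:R * K%:R :> R by rewrite -natrM ler0n.
  by have : 0 <= n%:R :> R by []; lra.
have d0 : 0 < delta%:R :> R by rewrite ltr0n delta_gt0.
move=> H1 H2; rewrite -(ler_pM2l d0) mulr1; apply: le_trans H2.
by rewrite mulrCA mulrA ler_wpM2r.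
Qed.

(** At a vertex of [X] with value 1 the equation would give a <= 2 deg(u0) <= 2 delta. *)
Let u0X : u0 \notin X.
Proof.
apply/negP => u0X; have dx : (degr adj u0)%:R <= delta%:R :> R by rewrite ler_nat degX.
have := ef u0; rewrite fu0 !mulr1; have := deg_sum u0; rewrite ler_norml.
move: a_large n_largeR; rewrite !natrM.
have : 0 <= C%:R * K%:R :> R by rewrite -natrM ler0n.
have : 0 <= K%:R * delta%:R :> R by rewrite -natrM ler0n.
have : 0 <= delta%:R :> R by [].
have : 0 <= s%:R :> R by [].
by move=> H1 H2 H3 H4 H5 H6 /andP[H7 H8]; lra.
Qed.

(* Two vertices outside X have almost the same neighbourhood, hence almost the
   same degree and neighbour sum. *)
Lemma eigen_large w : w \notin X -> K%:R * (1 - f w) <= 1.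
Proof.
move=> wX.
have near v : v \notin X -> [/\ n%:R - C%:R <= (degr adj v)%:R :> R,
    (degr adj v)%:R <= n%:R :> R &
    `|\sum_(u | adj v u) f u - \sum_u f u| <= C%:R].
  move=> vX; have := nonnbrW vX; have := card_nonnbr (@adj_irr G) v.
  rewrite -/n => E leC; split.
  - by rewrite lerBlDr -natrD ler_nat; move: E leC; clear; lia.
  - by rewrite ler_nat; move: E; clear; lia.
  have : (#|nonnbr adj v| + 1)%:R <= C%:R :> R by rewrite ler_nat.
  rewrite SE natrD; have := sum_le_card (nonnbr adj v); have := f_le1 v.
  by rewrite !ler_norml => /andP[h1 h2] /andP[h3 h4] h5; apply/andP; split; lra.
have [d1 d2] := near w wX; rewrite ler_norml => /andP[d3 d4].
have [b1 b2] := near u0 u0X; rewrite ler_norml => /andP[b3 b4].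
have E0 := ef u0; rewrite fu0 !mulr1 in E0.
(* Subtracting the equations at [u0] and [w] leaves the difference of the degrees, at most C, and
   that of the neighbour sums, at most 2 C. *)
have E : (a - (degr adj w)%:R) * (1 - f w) <= 3 * C%:R.
  have := ef w; rewrite !mulrBl !mulrBr !mulr1; lra.
have big : 3 * C%:R * K%:R + 1 <= a - (degr adj w)%:R.
  move: a_large n_largeR; rewrite !natrM.
  have : 0 <= K%:R * delta%:R :> R by rewrite -natrM ler0n.
  have : 0 <= delta%:R :> R by [].
  have : 0 <= s%:R :> R by [].
  by lra.
have f1 : 0 <= 1 - f w by have := f_le1 w; rewrite ler_norml => /andP[]; lra.
have C1 : 1 <= C%:R :> R.
  by rewrite -[1]/(1%:R) ler_nat; apply: leq_trans (nonnbrW wX); rewrite leq_addl.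
have K0 : 0 <= K%:R :> R by [].
rewrite -(@ler_pM2l _ (3 * C%:R)) ?mulr1; last by lra.
rewrite mulrA; apply: le_trans E; rewrite ler_wpM2r //; lra.
Qed.

End EigenEstimates.

(** * Missing edges against crossing edges *)

Section MissingCrossing.
Local Open Scope ring_scope.

(** With eta = 1/K, the errors in [quadratic_bound] are at most 8 D/K + 6 s delta/K + 4 s^2/K, which
    is 1 - 1/K by the choice of [K]. Hence 4 m < 2 t + 1 for the numbers m and t of missing and
    crossing pairs, and integrality concludes. *)
Lemma missing_le_crossing (R : realType) (G : graph) (X : {set G}) (a : R)
    (f : G -> R) (delta D C K : nat) (s := #|X|) :
  C = (s + D + 1)%N -> K = (8 * D + 6 * s * delta + 4 * s * s + 1)%N ->
  (2 * s + 3 + delta + K * delta + 3 * C * K <= #|G|)%N -> (0 < delta)%N ->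
  eigenfunction a f -> (exists v, f v != 0) -> (2 * (#|G| - s - 1))%:R <= a ->
  (forall x, x \in X -> (degr adj x <= delta)%N) ->
  (missing_pairs X <= D)%N -> (2 * missing_pairs X <= crossing_pairs X)%N.
Proof.
move=> CE KE n_large delta_gt0 ef [v0 fv0] le_a degX leD.
have [u0 _ maxu] := @Order.TotalTheory.arg_maxP _ R G v0 predT (fun v => `|f v|) isT.
have fu0 : f u0 != 0.
  by rewrite -normr_gt0; apply: lt_le_trans (maxu v0 isT); rewrite normr_gt0.
(* Dividing by the signed value makes the entry of largest modulus equal to +1. *)
pose g v := f v / f u0.
have eg : eigenfunction a g.
  move=> v; rewrite /g -mulr_suml mulrA ef mulrDl; congr (_ + _); ring.
have gu0 : g u0 = 1 by rewrite /g divff.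
have g_le1 u : `|g u| <= 1.
  by rewrite normrM normfV ler_pdivrMr ?normr_gt0 // mul1r; apply: maxu.
have nonnbrW w : w \notin X -> (#|nonnbr adj w| + 1 <= C)%N.
  move=> wX; rewrite CE leq_add2r -(cardsID X) leq_add //.
    by apply: subset_leq_card; apply: subsetIr.
  apply: leq_trans leD; rewrite /missing_pairs (bigD1 w) /= ?leq_addr //.
  by rewrite inE.
have small := @eigen_small R G X a g delta C K eg g_le1 le_a delta_gt0 degX n_large.
have large := @eigen_large R G X a g delta C K u0 eg gu0 g_le1 le_a delta_gt0 degX
  nonnbrW n_large.
have K1 : 1 <= K%:R :> R by rewrite ler1n KE addn1.
have K0 : 0 < K%:R :> R by apply: lt_le_trans K1.
have cross : (crossing_pairs X <= s * delta)%N.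
  rewrite -sum_nat_const; apply: leq_sum => x xX; apply: leq_trans (degX x xX).
  by apply: subset_leq_card; apply/fintype.subsetP => w; rewrite !inE => /andP[].
have := @quadratic_bound R G X a g eg (K%:R^-1).
rewrite invr_ge0 ltW // invf_le1 // K1.
have Hx x : x \in X -> `|g x| <= K%:R^-1.
  by move=> xX; rewrite -(ler_pM2l K0) divff ?gt_eqF // small.
have Hw w : w \notin X -> 1 - K%:R^-1 <= g w <= 1.
  move=> wX; apply/andP; split; last by have := g_le1 w; rewrite ler_norml => /andP[].
  by rewrite lerBlDr -lerBlDl -(ler_pM2l K0) divff ?gt_eqF // large.
move=> /(_ isT isT Hx Hw le_a) main.
have KeqR : K%:R = 8 * D%:R + 6 * (s * delta)%:R + 4 * (s * s)%:R + 1 :> R.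
  by rewrite KE !natrD !natrM; ring.
have eta0 : 0 < K%:R^-1 :> R by rewrite invr_gt0.
have Keta : K%:R * K%:R^-1 = 1 :> R by rewrite divff // gt_eqF.
have leDR : (missing_pairs X)%:R <= D%:R :> R by rewrite ler_nat.
have crossR : (crossing_pairs X)%:R <= (s * delta)%:R :> R by rewrite ler_nat.
have M0 : 0 <= (missing_pairs X)%:R :> R by [].
have T0 : 0 <= (crossing_pairs X)%:R :> R by [].
have S0 : 0 <= (s * s)%:R :> R by [].
have eta1 : K%:R^-1 <= 1 :> R by rewrite invf_le1.
suff : (4 * missing_pairs X)%:R < (2 * crossing_pairs X + 1)%:R :> R.
  by rewrite ltr_nat; clear; lia.
rewrite natrD !natrM; move: KeqR eta0 Keta leDR crossR M0 T0 S0 eta1 main.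
move: (K%:R : R) (D%:R : R) ((s * delta)%:R : R) ((s * s)%:R : R)
  ((missing_pairs X)%:R : R) ((crossing_pairs X)%:R : R)
  (K%:R^-1 : R); clear.
move=> kk d sd ss m t h E h0 kh md tsd m0 t0 s0 h1 H.
have hh : h ^+ 2 <= h by rewrite expr2 ler_piMl // ltW.
have A1 : 4 * (1 - 2 * h) * m <= 4 * (1 - h) ^+ 2 * m.
  by rewrite ler_wpM2r //; have := sqr_ge0 h; lra.
have A2 : 2 * (1 + h) ^+ 2 * t <= 2 * (1 + 3 * h) * t.
  rewrite ler_wpM2r //; have -> : (1 + h) ^+ 2 = 1 + 2 * h + h ^+ 2 by ring.
  by lra.
have A3 : 4 * h ^+ 2 * ss <= 4 * h * ss by rewrite ler_wpM2r //; lra.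
have B1 : h * m <= h * d by rewrite ler_pM2l.
have B2 : h * t <= h * sd by rewrite ler_pM2l.
have : 8 * (h * d) + 6 * (h * sd) + 4 * (h * ss) = 1 - h.
  by transitivity (kk * h - h); [rewrite E; ring | rewrite kh].
by lra.
Qed.

End MissingCrossing.

(** * Identification of the extremal families *)

Section Isomorphism.

(** The ordered pairs of increasing [enum_rank] represent all unordered ones, and their reversals
    form a disjoint subset of [M] of the same size. *)
Lemma card_unordered_pairs (T : finType) (M : {set T * T}) :
  (forall p, p \in M -> (p.2, p.1) \in M) -> (forall p, p \in M -> p.1 != p.2) ->
  2 * #|[set [set p.1; p.2] | p in M]| <= #|M|.
Proof.
move=> symM irrM; pose L := [set p in M | enum_rank p.1 < enum_rank p.2].
have E : [set [set p.1; p.2] | p in M] = [set [set p.1; p.2] | p in L].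
  apply/setP => a; apply/imsetP/imsetP => [[p pM ->]|[p pL ->]]; last first.
    by exists p => //; move: pL; rewrite inE => /andP[].
  have [lt|gt|/val_inj/enum_rank_inj eq] := ltngtP (enum_rank p.1) (enum_rank p.2).
  - by exists p => //; rewrite inE pM.
  - by exists (p.2, p.1); rewrite ?inE ?symM // finset.setUC.
  - by have := irrM p pM; rewrite eq eqxx.
have swapL : #|[set (p.2, p.1) | p in L]| = #|L|.
  by apply: card_imset => -[x y] [x' y'] [-> ->].
rewrite E mul2n -addnn; apply: leq_trans (_ : #|L| + #|[set (p.2, p.1) | p in L]| <= _).
  by rewrite swapL leq_add ?leq_imset_card.
rewrite -cardsUI [L :&: _](_ : _ = finset.set0) ?cards0 ?addn0.
  apply: subset_leq_card; rewrite finset.subUset; apply/andP; split; apply/fintype.subsetP.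
    by move=> p; rewrite inE => /andP[].
  by move=> _ /imsetP[p pL ->]; apply: symM; move: pL; rewrite inE => /andP[].
apply/setP => p; rewrite !inE; apply/negP => /andP[/andP[_ lt]] /imsetP[q].
by rewrite inE => /andP[_ lt'] pq; move: lt; rewrite pq /= ltnNge ltnW.
Qed.

(** [E'] consists of the edges of [J] that [h] maps to non-edges of [G]. By [adjX] they avoid [X],
    so both orders of each are missing pairs. *)
Lemma iso_delete_edges (J G : graph) (X : {set G}) (h : J -> G) :
  bijective h -> (forall u v, adj (h u) (h v) -> adj u v) ->
  (forall u v, h u \in X -> adj u v -> adj (h u) (h v)) ->
  exists E' : {set {set J}},
    [/\ E' \subset edges J, forall a v, a \in E' -> v \in a -> h v \notin X,
        2 * #|E'| <= missing_pairs X & iso G (delete_edges E')].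
Proof.
move=> bij_h adj_h adjX.
pose M := [set p : J * J | adj p.1 p.2 && ~~ adj (h p.1) (h p.2)].
have inj_h := bij_inj bij_h.
have symM p : p \in M -> (p.2, p.1) \in M.
  by rewrite !inE /= adj_sym [adj (h _) _]adj_sym.
have outX (p : J * J) : p \in M -> (h p.1 \notin X) && (h p.2 \notin X).
  move=> pM; have := symM p pM; move: pM; rewrite !inE /=.
  move=> /andP[adjp nadjp] /andP[adjp' nadjp']; apply/andP; split.
    by apply: contra nadjp => H; apply: adjX.
  by apply: contra nadjp' => H; apply: adjX.
pose E' := [set [set p.1; p.2] | p in M].
have ME u v : ([set u; v] \in E') = ((u, v) \in M).
  apply/imsetP/idP => [[p pM /set2_eq[[-> ->]|[-> ->]]]|H]; last by exists (u, v).
    by rewrite -surjective_pairing.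
  exact: symM.
exists E'; split.
- apply/fintype.subsetP => _ /imsetP[p pM ->].
  rewrite inE; apply/existsP; exists p.1; apply/existsP; exists p.2.
  by move: pM; rewrite inE eqxx andbT => /andP[].
- move=> _ v /imsetP[p pM ->]; have /andP[H1 H2] := outX _ pM.
  by rewrite finset.in_set2 => /orP[]/eqP->.
- apply: leq_trans (card_unordered_pairs symM _) _.
    move=> p; rewrite inE => /andP[adjp _]; apply: contraTneq adjp => ->.
    by rewrite adj_irr.
  have inj2 : injective (fun p : J * J => (h p.1, h p.2)).
    by move=> [x y] [x' y'] [/inj_h -> /inj_h ->].
  rewrite -(card_imset _ inj2) missing_pairsE pair_big /= -sum1_card big_mkcond /=.
  apply: leq_sum => q _; case: imsetP => // -[p pM ->] /=.
  have /andP[-> ->] := outX _ pM; move: pM; rewrite inE => /andP[adjp ->].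
  rewrite andbT (inj_eq inj_h) /= lt0b.
  by apply: contraTneq adjp => ->; rewrite adj_irr.
- have [h' hK h'K] := bij_h.
  exists h'; first by exists h.
  move=> u v; rewrite -[in RHS](h'K u) -[in RHS](h'K v).
  rewrite -[LHS]/(delete_rel E' (h' u) (h' v)) /delete_rel ME inE /=.
  apply/andP/idP => [[H]|H]; first by rewrite H negbK.
  by rewrite H andbF; split=> //; apply: adj_h.
Qed.

Lemma join_bijection (G : graph) (X Y : {set G}) (A B C : graph) :
  [disjoint X & Y] -> #|Y| = #|A| -> #|X| = #|C| -> #|G| = #|A| + (#|B| + #|C|) ->
  exists h : join A (disjoint_union B C) -> G, bijective h /\
   [/\ forall a, h (inl a) \in Y, forall b, h (inr (inl b)) \notin X :|: Y
     & forall c, h (inr (inr c)) \in X].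
Proof.
move=> disj cardY cardX cardG.
have cardZ : #|~: (X :|: Y)| = #|B|.
  apply/eqP; rewrite -(eqn_add2l #|X :|: Y|) cardsC cardG.
  have /eqP -> : #|X :|: Y| == #|X| + #|Y| by rewrite (eq_leqif (leq_card_setU X Y)).
  by rewrite cardX cardY; apply/eqP; clear; lia.
pose h (v : join A (disjoint_union B C)) : G :=
  match v with
  | inl a => enum_val (cast_ord (esym cardY) (enum_rank a))
  | inr (inl b) => enum_val (cast_ord (esym cardZ) (enum_rank b))
  | inr (inr c) => enum_val (cast_ord (esym cardX) (enum_rank c))
  end.
have hA a : h (inl a) \in Y by apply: enum_valP.
have hB b : h (inr (inl b)) \notin X :|: Y by rewrite -finset.in_setC; apply: enum_valP.
have hC c : h (inr (inr c)) \in X by apply: enum_valP.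
exists h; split; last by split.
have XY u : u \in X -> u \in Y -> False by move=> uX; rewrite (disjointFr disj).
have notB u b : u = h (inr (inl b)) -> u \in X :|: Y -> False.
  by move=> -> H; have := hB b; rewrite H.
apply: inj_card_bij.
  move=> [a|[b|c]] [a'|[b'|c']] E.
  - by move: E => /= /enum_val_inj/cast_ord_inj/enum_rank_inj ->.
  - by case: (notB _ _ E); rewrite inE hA orbT.
  - by case: (XY _ (hC c')); rewrite -E.
  - by case: (notB _ _ (esym E)); rewrite inE hA orbT.
  - by move: E => /= /enum_val_inj/cast_ord_inj/enum_rank_inj ->.
  - by case: (notB _ _ (esym E)); rewrite inE hC.
  - by case: (XY _ (hC c)); rewrite E.
  - by case: (notB _ _ E); rewrite inE hC.
  - by move: E => /= /enum_val_inj/cast_ord_inj/enum_rank_inj ->.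
by rewrite cardG !card_sum.
Qed.

End Isomorphism.

Lemma crossing_pairs_complete (G : graph) (X Y : {set G}) : [disjoint X & Y] ->
  (forall x w, x \in X -> w \notin X -> adj x w = (w \in Y)) ->
  crossing_pairs X = #|X| * #|Y|.
Proof.
move=> disj XY; rewrite -sum_nat_const; apply: eq_bigr => x xX; apply: eq_card => w.
rewrite !inE; have [wX|wX] /= := boolP (w \in X); first by rewrite (disjointFr disj).
by rewrite XY.
Qed.

(** Common to both families: [b] is the adjacency inside [X], false for [H_graph] and true for
    [L_graph]. *)
Lemma two_block_iso (G C : graph) (X Y : {set G}) (y z : nat) (b : bool) :
  [disjoint X & Y] -> #|Y| = y -> #|X| = #|C| -> #|G| = y + (z + #|C|) ->
  (forall x w, x \in X -> w \notin X -> adj x w = (w \in Y)) ->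
  (forall x u, x \in X -> u \in X -> x != u -> adj x u = b) ->
  (forall c d : C, c != d -> adj c d = b) ->
  2 * missing_pairs X <= crossing_pairs X ->
  exists E' : {set {set join (complete y) (disjoint_union (complete z) C)}},
    [/\ E' \subset edges_YZ (complete y) (complete z) C,
        #|E'| <= (y * #|C|) %/ 4 & iso G (delete_edges E')].
Proof.
move=> disj cardY cardX cardG XY adjXX adjCC missing.
have [||h [bij_h [hY hZ hX]]] :=
    @join_bijection G X Y (complete y) (complete z) C disj _ cardX.
- by rewrite cardY card_ord.
- by rewrite cardG !card_ord.
have inj_h := bij_inj bij_h.
have YnotX u : u \in Y -> u \notin X by move=> uY; rewrite (disjointFl disj).
have Znot v : (h (inr (inl v)) \in X = false) /\ (h (inr (inl v)) \in Y = false).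
  by have := hZ v; rewrite inE negb_or => /andP[/negPf -> /negPf ->].
have neq (u v : join (complete y) (disjoint_union (complete z) C)) :
    adj (h u) (h v) -> u != v.
  by apply: contraTneq => ->; rewrite adj_irr.
have adjZX v c : adj (h (inr (inr c))) (h (inr (inl v))) = false.
  by have [HX HY] := Znot v; rewrite XY ?HX ?HY.
have adjC c d : c != d -> adj (h (inr (inr c))) (h (inr (inr d))) = adj c d.
  move=> cd; rewrite adjXX ?adjCC //.
  by apply: contra cd => /eqP /inj_h [->].
have [||E' [subE outE cardE isoE]] := iso_delete_edges (X := X) bij_h.
- move=> [a|[v|c]] [a'|[v'|c']] //= H; first by have := neq _ _ H.
  + by have := neq _ _ H.
  + by rewrite adj_sym adjZX in H.
  + by rewrite adjZX in H.
  + by rewrite -adjC //; apply: contraTneq H => ->; rewrite adj_irr.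
- move=> [a|[v|c]] w uX.
  + by have := YnotX _ (hY a); rewrite uX.
  + by have [] := Znot v; rewrite uX.
  case: w => [a|[v|d]] //= H; first by rewrite XY ?hY // YnotX.
  by rewrite adjC //; apply: contraTneq H => ->; rewrite adj_irr.
exists E'; split=> //.
  apply/fintype.subsetP => a aE; rewrite inE (fintype.subsetP subE _ aE) /=.
  apply/fintype.subsetP => v va; have := outE a v aE va.
  case: v {va} => [u|[u|u]] H; rewrite inE.
  - by rewrite imset_f.
  - by rewrite orbC imset_f.
  - by rewrite hX in H.
(* The chain is 4 #|E'| <= 2 [missing_pairs X] <= [crossing_pairs X] = y #|C|. *)
rewrite leq_divRL // mulnC.
have := crossing_pairs_complete disj XY; rewrite cardX cardY.
by move: cardE missing; clear; lia.
Qed.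

(** * Choice of the threshold and conclusion *)

Lemma min_degree_le (G : graph) (v : G) : min_degree G <= degr adj v.
Proof.
rewrite /min_degree; have : v \in index_enum G by rewrite mem_index_enum.
elim: (index_enum G) => // u r IH; rewrite inE big_cons geq_min.
by move=> /orP[/eqP->|/IH ->]; rewrite ?leqnn ?orbT.
Qed.

Local Open Scope ring_scope.

Theorem theorem2p3 (k delta : nat) (hdelta : (k + 2 <= delta)%N) :
  exists n0 : nat, forall (R : realType) (n : nat) (G : graph),
    (n0 <= n)%N -> #|G| = n -> (delta <= min_degree G)%N ->
    2 * (n%:R - delta%:R + k%:R - 1) <= signless_radius R G ->
    edge_hamiltonian k G \/ family_H n k delta G \/ family_L n k delta G.
Proof.
pose s := (delta - k)%N; have deltaE : delta = (k + s)%N by rewrite subnKC //; lia.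
have s_ge2 : (2 <= s)%N by lia.
(* [D] is the bound of [two_block_spanning]; [C] and [K] are dictated by [missing_le_crossing]. [n1]
   serves the combinatorial structure, [n2] the eigenvector estimates. *)
pose D := (2 * s * (k + s) + s * s)%N.
pose C := (s + D + 1)%N; pose K := (8 * D + 6 * s * delta + 4 * s * s + 1)%N.
pose n1 := ((s + 1) * (k + 1 + 8 * s) + 32 * s * s + 2 * k + 16 * s + 2)%N.
pose n2 := (2 * s + 3 + delta + K * delta + 3 * C * K)%N.
exists (n1 + n2)%N => R n G n_ge cardG min_deg radius.
have n_ge1 : (n1 <= #|G|)%N by rewrite cardG (leq_trans _ n_ge) // leq_addr.
have n_ge2 : (n2 <= #|G|)%N by rewrite cardG (leq_trans _ n_ge) // leq_addl.
have deg_ge (v : G) : (delta <= degr adj v)%N := leq_trans min_deg (min_degree_le v).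
have deg_ge' (v : G) : (k + s <= degr adj v)%N by rewrite -deltaE.
have n_large : (2 * s + 3 + delta <= n)%N.
  by rewrite -cardG (leq_trans _ n_ge2) // /n2 -[leqRHS]addnA leq_addr.
have E : 2 * (n%:R - delta%:R + k%:R - 1) = (2 * (n - s - 1))%:R :> R.
  rewrite natrM natrB; last by lia.
  by rewrite natrB; [rewrite deltaE natrD; ring | lia].
rewrite E in radius.
have [|a eig_a le_a] := signless_radius_attained _ radius.
  by rewrite ltr0n; move: n_large; clear; lia.
have [f ef f0] := eigenvalue_fun eig_a.
rewrite -cardG in le_a.
have deg_gt0 (u : G) : (0 < degr adj u)%N.
  by apply: leq_trans (deg_ge u); move: hdelta; clear; lia.
have few := edge_bound deg_gt0 ef f0 le_a.
(* Membership in a family settles the claim, so it is enough that a single non-extendable path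
   system puts [G] in one of them. *)
have [fam|nofam] := boolp.pselect (family_H n k delta G \/ family_L n k delta G).
  by right.
left=> ps paths U le_k; apply: boolp.contrapT => nonham; apply: nofam.
have [e [X [Y [r [sub_e e_sym blk r_or]]]]] :=
  nonham_two_block s_ge2 n_ge1 deg_ge' few paths U le_k nonham.
have [adjE missD] := two_block_spanning n_ge1 deg_ge' few sub_e e_sym blk.
have [cardX disj _ XY [reg cardY]] := blk.
have degX x : x \in X -> (degr adj x <= delta)%N.
  move=> xX; rewrite deltaE -(degr_two_block blk xX); exact: degr_sub.
have missing : (2 * missing_pairs X <= crossing_pairs X)%N.
  apply: (missing_le_crossing (D := D) (erefl _) (erefl _) _ _ ef f0 _ degX missD);
    rewrite ?cardX //.
  by move: hdelta; clear; lia.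
have adjXY x w : x \in X -> w \notin X -> adj x w = (w \in Y).
  by move=> xX wX; rewrite adjE // XY.
(* r = 0 makes [X] independent with #|Y| = delta; r = s - 1 makes it a clique with #|Y| = k + 1. *)
case: r_or => [r0|r1]; [left|right].
- have [|||||E' [H1 H2 H3]] :=
    @two_block_iso G (edgeless s) X Y delta (n + k - 2 * delta) false
      disj _ _ _ adjXY _ _ missing.
  + by rewrite deltaE -cardY r0 addn0.
  + by rewrite card_ord.
  + by rewrite card_ord cardG; move: n_large deltaE; clear; lia.
  + move=> x u xX uX _; rewrite adjE //; apply/negbTE/negP => exu.
    have /eqP := reg x xX; rewrite r0 cards_eq0 => /eqP/setP/(_ u).
    by rewrite !inE uX exu.
  + by [].
  by exists E'; split=> //; rewrite card_ord in H2.
- have [|||||E' [H1 H2 H3]] :=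
    @two_block_iso G (complete s) X Y k.+1 (n - delta - 1) true
      disj _ _ _ adjXY _ _ missing.
  + by move: cardY; rewrite -r1; clear; lia.
  + by rewrite card_ord.
  + by rewrite card_ord cardG; move: n_large deltaE; clear; lia.
  + move=> x u xX uX xu; rewrite adjE //; apply: contraT => nexu.
    have : (#|[set v in X | e x v]| <= #|X :\ x :\ u|)%N.
      apply: subset_leq_card; apply/fintype.subsetP => v; rewrite !inE.
      move=> /andP[-> exv]; rewrite andbT; apply/andP; split.
        by apply: contraNneq nexu => <-.
      apply: contraTneq exv => ->; rewrite -adjE // adj_irr //.
    rewrite reg //; have := cardsD1 x X; have := cardsD1 u (X :\ x).
    rewrite !inE xX uX eq_sym xu cardX -r1 /=; clear; lia.
  + by [].
  by exists E'; split=> //; rewrite card_ord in H2.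
Qed.
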